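(* Let $\alpha=\sum_{n=0}^\infty\alpha(n)\delta_n$ be the probability on $\mathbb{N}=\{0,1,2,\ldots\}$ defined by $$\sum_{n=0}^{\infty}\alpha(n)z^n=\exp\Big(-\frac{\pi^2}{4}+2\,Li_2(z)-\frac12\,Li_2(z^2)\Big),\qquad |z|\le1,$$ which generates the exponential family with variance function $\sinh m$ on $(0,\infty)$. Then $\alpha$ is a dual measure of itself.
   Context: $Li_2(z)=\sum_{n=1}^\infty z^n/n^2$ for $|z|\le1$. For a positive measure $\mu$ on $\mathbb{R}$ let $B_\mu(s)=\int_{\mathbb{R}}e^{-sx}\mu(dx)$, let $S(\mu)$ be the interior of $\{s: B_\mu(s)<\infty\}$, and $\ell_\mu=\log B_\mu$. $\mathcal{M}(\mathbb{R})$ is the set of positive measures on $\mathbb{R}$ not concentrated on one point and with $S(\mu)\neq\emptyset$. The natural exponential family generated by $\mu\in\mathcal{M}(\mathbb{R})$ is $F(\mu)=\{e^{-sx-\ell_\mu(s)}\mu(dx): s\in S(\mu)\}$; $M_{F(\mu)}=-\ell'_\mu(S(\mu))$ is the set of its means; with $\varphi_\mu$ the inverse of $s\mapsto-\ell'_\mu(s)$, its variance function is $V_{F(\mu)}(m)=\ell''_\mu(\varphi_\mu(m))$. A measure $\mu^*\in\mathcal{M}(\mathbb{R})$ is a dual measure of $\mu$ if $M_{F(\mu)}\subset S(\mu^* )$ and $-\ell'_{\mu^*}(-\ell'_\mu(s))=s$ for all $s\in S(\mu)$. *)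

(* Defs.v *)
From HB Require Import structures.
From mathcomp Require Export all_boot all_order all_algebra.
From mathcomp Require Export all_classical all_reals all_analysis.
From mathcomp Require Export complex.

Set Implicit Arguments.
Unset Strict Implicit.
Unset Printing Implicit Defensive.

Export Order.TTheory GRing.Theory Num.Theory.
Export numFieldNormedType.Exports.

Local Open Scope classical_set_scope.
Local Open Scope ring_scope.

Definition sinh (R : realType) (x : R) : R := (expR x - expR (- x)) / 2.

Definition cexp (R : realType) (z : R[i]) : R[i] :=
  (expR (complex.Re z))%:C%C *
  (cos (complex.Im z) +i* sin (complex.Im z))%C.

(* [R[i]^o] carries the topology given by the modulus. *)
Definition Li2 (R : realType) (z : R[i]) : R[i] :=
  limn (series (fun k : nat => z ^+ k.+1 / k.+1%:R ^+ 2 : R[i]^o)).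

Section exponential_families.
Variable R : realType.
Implicit Types mu nu : {measure set (measurableTypeR R) -> \bar R}.

Definition laplace mu (s : R) : \bar R :=
  (\int[mu]_x (expR (- (s * x)))%:E)%E.

Definition laplace_domain mu : set R :=
  [set s : R | (laplace mu s < +oo)%E]°.

(* Meaningful on [laplace_domain mu] only, where [laplace mu] is finite. *)
Definition log_laplace mu (s : R) : R := ln (fine (laplace mu s)).

Definition in_M mu : Prop :=
  (forall x : R, mu (~` [set x]) != 0%E) /\ laplace_domain mu !=set0.

Definition neg_dlog mu (s : R) : R := - ((log_laplace mu)^`())%classic s.

Definition mean_domain mu : set R := neg_dlog mu @` laplace_domain mu.

(* Inverse, defined on [mean_domain mu], of [neg_dlog mu] restricted to
   [laplace_domain mu]. *)
Definition mean_inverse mu : R -> R :=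
  'pinv_(fun=> 0) (laplace_domain mu) (neg_dlog mu).

Definition variance_function mu (m : R) : R :=
  ((log_laplace mu)^`(2))%classic (mean_inverse mu m).

Definition dual_measure mu nu : Prop :=
  [/\ in_M nu,
      mean_domain mu `<=` laplace_domain nu &
      forall s : R, laplace_domain mu s -> neg_dlog nu (neg_dlog mu s) = s].

(* The measure [\sum_n a n * \delta_n], carried by the natural numbers seen as
   points of the real line. *)
Definition nat_measure (a : nat -> {nonneg R}) :
    {measure set (measurableTypeR R) -> \bar R} :=
  mseries (fun n : nat => mscale (a n) (dirac (n%:R : measurableTypeR R))) 0%N.

Definition alpha_spec (a : nat -> {nonneg R}) : Prop :=
  nat_measure a setT = 1%E /\
  forall z : R[i], `|z| <= 1 ->
    series (fun n : nat => ((a n)%:num)%:C%C * z ^+ n : R[i]^o) @ \oo -->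
    (cexp (- (pi ^+ 2 / 4)%:C%C + 2 * Li2 z - 2^-1 * Li2 (z ^+ 2)) : R[i]^o).

End exponential_families.

(* Main.v *)
Require Import Defs.
From mathcomp Require Import measurable_realfun.
From mathcomp Require Import ring lra zify.

(** On the closed unit disc the even powers cancel in
    [2 Li2(z) - Li2(z^2)/2], which is therefore [P(z) = sum_n c_n z^n] with
    [c_n = 2/n^2] for odd [n] and [c_n = 0] for even [n]
    ([cvg_odd_exponent]).  Since [c_n >= 0], the formal exponential of this
    series has nonnegative coefficients [b_n], and [a_n = exp(-pi^2/4) b_n]
    are the weights sought.

    Existence.  That [sum_n b_n z^n = exp(P(z))] on the whole closed disc is
    [cvg_exp_coef].  If [P_N] and [A_N] are the truncations of the two series,
    the derivative of [t |-> exp(-P_N(tz)) A_N(tz)] is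
    [- z exp(-P_N(tz)) r_N(tz)], where [r_N = P_N' A_N - A_N'] has nonnegative
    coefficients, vanishing below degree [N] and at most [(n+1) b_(n+1)] in
    degree [n].  Hence on [[0, 1]] this function moves by at most a constant
    times the tail [sum_(n > N) b_n], uniformly in [z]; it starts at [1], so it
    ends near [1].  The total mass is one because [P(1) = pi^2/4], that is,
    because the inverse odd squares add up to [pi^2/8]
    ([cvg_series_inv_odd_sqr]).

    Uniqueness.  A summable power series vanishing on []0, 1]] is zero
    ([power_series_eq0]), so the values on the unit interval already determine
    the weights ([alpha_coef_unique]).

    Duality.  The Laplace transform at [s >= 0] is
    [exp(P(exp(-s)) - pi^2/4)], and it is infinite for [s < 0] because
    [b_n >= c_n] decays only polynomially; so its domain has interior
    []0, +oo[].  As [x P'(x) = 2 sum_(n odd) x^n / n = ln((1 + x)/(1 - x))], the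
    mean map [- (log B)'] is [s |-> ln((1 + exp(-s))/(1 - exp(-s)))
    = - ln(tanh(s/2))].  With [x = exp(-s)] this is the Moebius map
    [x |-> (1 - x)/(1 + x)], an involution of []0, 1[]: the mean map is its own
    inverse on []0, +oo[], which is self-duality.  Its derivative is
    [- 1/sinh s], and an involution exchanging [s] and [m] satisfies
    [sinh s sinh m = 1], so the variance function is [sinh]. *)

Set Implicit Arguments.
Unset Strict Implicit.
Unset Printing Implicit Defensive.

Local Open Scope classical_set_scope.
Local Open Scope ring_scope.

(** * Increments compared through derivatives *)

Lemma is_derive_eqfun (R : realType) (f g : R -> R) (x d : R) :
  f =1 g -> is_derive x 1 f d -> is_derive x 1 g d.
Proof. by move=> /funext ->. Qed.

Lemma le_increment (R : realType) (f h df dh : R -> R) (a b : R) :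
  a <= b ->
  (forall t : R, is_derive t 1 f (df t)) ->
  (forall t : R, is_derive t 1 h (dh t)) ->
  (forall t, a <= t <= b -> df t <= dh t) ->
  f b - f a <= h b - h a.
Proof.
move=> ab Df Dh le_d.
have D (t : R) : is_derive t 1 (h \- f) (dh t - df t) by exact: is_deriveB.
have [|c cab] := @MVT_segment R (h \- f) (fun t => dh t - df t) a b ab (fun t _ => D t).
  apply/continuous_subspaceT => t.
  exact/differentiable_continuous/derivable1_diffP.
rewrite /= => E; rewrite -subr_ge0.
have -> : h b - h a - (f b - f a) = (dh c - df c) * (b - a).
  by rewrite -E; ring.
by rewrite mulr_ge0 ?subr_ge0// le_d//; move: cab; rewrite in_itv.
Qed.

Lemma norm_le_increment (R : realType) (f h df dh : R -> R) (a b : R) :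
  a <= b ->
  (forall t : R, is_derive t 1 f (df t)) ->
  (forall t : R, is_derive t 1 h (dh t)) ->
  (forall t, a <= t <= b -> `|df t| <= dh t) ->
  `|f b - f a| <= h b - h a.
Proof.
move=> ab Df Dh le_d; rewrite ler_norml; apply/andP; split.
  rewrite lerNl.
  have -> : - (f b - f a) = (\- f) b - (\- f) a by rewrite /=; ring.
  apply: (@le_increment R (\- f) h (\- df) dh) => // t tab.
  by have := le_d t tab; rewrite ler_norml => /andP[]; rewrite lerNl.
apply: (le_increment ab Df Dh) => t tab.
by apply: le_trans (ler_norm _) (le_d t tab).
Qed.

Lemma is_derive_Re_horner (R : realType) (Q : {poly R[i]}) (t : R) :
  is_derive t 1 (fun t : R => complex.Re Q.[t%:C%C]) (complex.Re Q^`().[t%:C%C]).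
Proof.
elim/poly_ind: Q => [|Q c IH].
  rewrite deriv0 horner0; apply: is_derive_eqfun (is_derive_cst (0 : R) t 1).
  by move=> x /=; rewrite horner0.
apply: (@is_derive_eqfun R (fun t => complex.Re Q.[t%:C%C] * t + complex.Re c)).
  by move=> x; rewrite hornerMXaddC; case: Q.[_] c => [a b] [c d] /=; ring.
apply: is_derive_eq.
rewrite derivMXaddC hornerD hornerMX /=.
case: Q.[_] Q^`().[_] => [a b] [c' d] /=.
rewrite /GRing.scale /=; ring.
Qed.

Lemma is_derive_Im_horner (R : realType) (Q : {poly R[i]}) (t : R) :
  is_derive t 1 (fun t : R => complex.Im Q.[t%:C%C]) (complex.Im Q^`().[t%:C%C]).
Proof.
have ImE (z : R[i]) : complex.Im z = complex.Re (- 'i%C * z).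
  by case: z => x y /=; ring.
have := is_derive_Re_horner ((- 'i%C)%:P * Q) t.
rewrite derivM derivC mul0r add0r hornerCM -ImE.
by apply: is_derive_eqfun => x; rewrite hornerCM -ImE.
Qed.

(** The real part of [exp(-w) y] for [w = p + i q] and [y = u + i v].  Replacing
    [(u, v)] by [(v, -u)], that is [y] by [- i y], yields the imaginary part, so
    bounds are needed for this function only. *)
Definition Re_expN_mul (R : realType) (p q u v : R -> R) (t : R) : R :=
  expR (- p t) * (u t * cos (q t) + v t * sin (q t)).

(** The hypotheses on [du] and [dv] bound the real and imaginary parts of
    [y' - w' y], the factor left by [exp(-w)] in the derivative of
    [exp(-w) y]. *)
Lemma variation_Re_expN_mul (R : realType) (p q u v h dp dq du dv dh : R -> R)
    (K : R) :
  (forall t : R, is_derive t 1 p (dp t)) ->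
  (forall t : R, is_derive t 1 q (dq t)) ->
  (forall t : R, is_derive t 1 u (du t)) ->
  (forall t : R, is_derive t 1 v (dv t)) ->
  (forall t : R, is_derive t 1 h (dh t)) ->
  (forall t, 0 <= t <= 1 -> `|p t| <= K) ->
  (forall t, 0 <= t <= 1 -> `|du t - (dp t * u t - dq t * v t)| <= dh t) ->
  (forall t, 0 <= t <= 1 -> `|dv t - (dp t * v t + dq t * u t)| <= dh t) ->
  `|Re_expN_mul p q u v 1 - Re_expN_mul p q u v 0| <= 2 * expR K * (h 1 - h 0).
Proof.
move=> Dp Dq Du Dv Dh pK le_u le_v; set g := Re_expN_mul p q u v.
pose dg t := expR (- p t) * ((du t - (dp t * u t - dq t * v t)) * cos (q t) +
                             (dv t - (dp t * v t + dq t * u t)) * sin (q t)).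
have Dg t : is_derive t (1 : R) g (dg t).
  have Dc : is_derive t 1 (cos \o q) (- sin (q t) * dq t).
    exact: is_derive1_comp.
  have Ds : is_derive t 1 (sin \o q) (cos (q t) * dq t).
    exact: is_derive1_comp.
  have De : is_derive t 1 (expR \o (\- p)) (expR (- p t) * (- dp t)).
    exact: is_derive1_comp.
  have -> : dg t = (expR \o (\- p)) t *:
      ((u t *: (- sin (q t) * dq t) + (cos \o q) t *: du t) +
       (v t *: (cos (q t) * dq t) + (sin \o q) t *: dv t)) +
      (u \* (cos \o q) \+ v \* (sin \o q)) t *: (expR (- p t) * (- dp t)).
    have scE (a b : R) : a *: b = a * b by [].
    by rewrite /dg !scE /=; ring.
  have D := is_deriveM De (is_deriveD (is_deriveM (Du t) Dc) (is_deriveM (Dv t) Ds)).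
  exact: is_derive_eqfun D.
have -> : 2 * expR K * (h 1 - h 0) =
    (fun t => 2 * expR K * h t) 1 - (fun t => 2 * expR K * h t) 0.
  by rewrite mulrBr.
apply: (@norm_le_increment R g (fun t => 2 * expR K * h t) dg
   (fun t => 2 * expR K * dh t)) => //.
move=> t t01; rewrite /dg normrM ger0_norm ?expR_ge0//.
have -> : 2 * expR K * dh t = expR K * (2 * dh t) by ring.
apply: ler_pM; [exact: expR_ge0|exact: normr_ge0|..].
  rewrite ler_expR; apply: le_trans (ler_norm _) _.
  by rewrite normrN; apply: pK.
apply: le_trans (ler_normD _ _) _; rewrite !normrM mulr_natl mulr2n.
have le1 (x : R) : `|x| <= 1 -> forall y z : R, `|y| <= z -> `|y| * `|x| <= z.
  move=> x1 y z yz; apply: le_trans yz.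
  by rewrite ler_piMr.
by apply: lerD; [apply: (le1 (cos (q t)))|apply: (le1 (sin (q t)))];
  rewrite ?le_u ?le_v// ler_norml ?cos_le1 ?cos_geN1 ?sin_le1 ?sin_geN1.
Qed.

(** * Complex sequences by real and imaginary parts *)

Section complex_cvg.
Variable R : realType.

Lemma ReB (w w' : R[i]) : complex.Re (w - w') = complex.Re w - complex.Re w'.
Proof. by case: w w' => [? ?] [? ?]. Qed.

Lemma ImB (w w' : R[i]) : complex.Im (w - w') = complex.Im w - complex.Im w'.
Proof. by case: w w' => [? ?] [? ?]. Qed.

Lemma Re_Im_le (w : R[i]) (x : R) : `|w| <= x%:C%C ->
  `|complex.Re w| <= x /\ `|complex.Im w| <= x.
Proof.
move=> wx; split; rewrite -lecR; apply: le_trans wx; first exact: normc_ge_Re.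
have -> : complex.Im w = - complex.Re (w * 'i%C) by rewrite ReiNIm opprK.
rewrite normrN; apply: le_trans (normc_ge_Re _) _.
rewrite normrM [X in _ * X](_ : _ = 1) ?mulr1//.
by rewrite normc_def /= expr0n expr1n add0r sqrtr1.
Qed.

Lemma normc_le_ReIm (w : R[i]) :
  `|w| <= (`|complex.Re w| + `|complex.Im w|)%:C%C.
Proof.
rewrite [in leLHS](complexE w); apply: le_trans (ler_normD _ _) _.
rewrite rmorphD lerD//.
  by rewrite normc_def /= expr0n addr0 sqrtr_sqr.
by rewrite normrM !normc_def /= !expr0n !expr1n !(addr0, add0r) sqrtr1 mul1r sqrtr_sqr.
Qed.

Lemma cvg_complexP (u : nat -> R[i]) (l : R[i]) :
  (u : nat -> R[i]^o) @ \oo --> (l : R[i]^o) <->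
  (fun n => complex.Re (u n)) @ \oo --> complex.Re l /\
  (fun n => complex.Im (u n)) @ \oo --> complex.Im l.
Proof.
split.
  move=> /cvgrPdist_le ul.
  have H e : 0 < e -> \forall n \near \oo,
      `|complex.Re (l - u n)| <= e /\ `|complex.Im (l - u n)| <= e.
    move=> e0; have := ul e%:C%C; rewrite ltcE /= eqxx => /(_ e0); apply: filterS => n.
    exact: Re_Im_le.
  split; apply/cvgrPdist_le => e /H; apply: filterS => n []; by rewrite ReB ImB.
move=> [/cvgrPdist_le ul1 /cvgrPdist_le ul2]; apply/cvgrPdist_le => -[e e'].
rewrite ltcE /= => /andP[/eqP -> e0].
have e2 : 0 < e / 2 by rewrite divr_gt0.
near=> n.
apply: le_trans (normc_le_ReIm _) _; rewrite -[(e +i* 0)%C]/(e%:C%C) lecR.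
rewrite [e]splitr lerD//.
  have : `|complex.Re l - complex.Re (u n)| <= e / 2 by near: n; exact: ul1.
  by rewrite ReB.
have : `|complex.Im l - complex.Im (u n)| <= e / 2 by near: n; exact: ul2.
by rewrite ImB.
Unshelve. all: by end_near.
Qed.

Lemma Re_sum (I : Type) (s : seq I) (F : I -> R[i]) :
  complex.Re (\sum_(i <- s) F i) = \sum_(i <- s) complex.Re (F i).
Proof. by apply: (big_morph (@complex.Re R)) => // -[? ?] [? ?]. Qed.

Lemma Im_sum (I : Type) (s : seq I) (F : I -> R[i]) :
  complex.Im (\sum_(i <- s) F i) = \sum_(i <- s) complex.Im (F i).
Proof. by apply: (big_morph (@complex.Im R)) => // -[? ?] [? ?]. Qed.

Lemma Re_series_real (f : nat -> R) (x : R) N :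
  complex.Re (series (fun n => (f n)%:C%C * x%:C%C ^+ n) N) =
  series (fun n => f n * x ^+ n) N.
Proof.
rewrite /series /= Re_sum; apply: eq_bigr => k _.
by rewrite -rmorphXn -rmorphM.
Qed.

Lemma Im_series_real (f : nat -> R) (x : R) N :
  complex.Im (series (fun n => (f n)%:C%C * x%:C%C ^+ n) N) = 0.
Proof. by rewrite /series /= Im_sum big1// => k _; rewrite -rmorphXn -rmorphM. Qed.

Lemma is_cvg_complex_series (f : nat -> R[i]) (g : nat -> R) :
  (forall n, `|f n| <= (g n)%:C%C) -> cvgn (series g) ->
  cvgn (series (f : nat -> R[i]^o)).
Proof.
move=> fg cg.
have g0 n : 0 <= g n by rewrite -ler0c; exact: le_trans (fg n).
have cRe : cvgn (series (@complex.Re R \o f)).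
  apply: normed_cvg; apply: (series_le_cvg _ g0 _ cg) => n //=.
  by have [] := Re_Im_le (fg n).
have cIm : cvgn (series (@complex.Im R \o f)).
  apply: normed_cvg; apply: (series_le_cvg _ g0 _ cg) => n //=.
  by have [] := Re_Im_le (fg n).
apply/cvg_ex; exists ((limn (series (@complex.Re R \o f)) +i*
                     limn (series (@complex.Im R \o f)))%C : R[i]^o).
apply/cvg_complexP; split => /=.
  rewrite (_ : (fun n => _) = series (@complex.Re R \o f))//.
  by apply/funext => n; rewrite /series /= Re_sum.
rewrite (_ : (fun n => _) = series (@complex.Im R \o f))//.
by apply/funext => n; rewrite /series /= Im_sum.
Qed.

End complex_cvg.

(** * The exponential of a power series with nonnegative coefficients *)

(** The first [n.+1] coefficients of the exponential [B] of the power series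
    with coefficients [c] and zero constant term, computed from the differential
    equation [B' = C' B]. *)
Fixpoint exp_coef_seq (R : realType) (c : nat -> R) (n : nat) : seq R :=
  if n is m.+1 then
    let s := exp_coef_seq c m in
    rcons s ((\sum_(k < m.+1) k.+1%:R * c k.+1 * s`_(m - k)) / m.+1%:R)
  else [:: 1].

Definition exp_coef (R : realType) (c : nat -> R) (n : nat) : R :=
  (exp_coef_seq c n)`_n.

Section exp_coef.
Variables (R : realType) (c : nat -> R).
Local Notation b := (exp_coef c).

Lemma size_exp_coef_seq n : size (exp_coef_seq c n) = n.+1.
Proof. by elim: n => //= n IH; rewrite size_rcons IH. Qed.

Lemma nth_exp_coef_seq n i : (i <= n)%N -> (exp_coef_seq c n)`_i = b i.
Proof.
elim: n => [|n IH]; first by rewrite leqn0 => /eqP ->.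
rewrite leq_eqVlt => /orP[/eqP -> //|ilt].
by rewrite /= nth_rcons size_exp_coef_seq ilt IH.
Qed.

Lemma exp_coef0 : b 0%N = 1. Proof. by []. Qed.

Lemma exp_coefS n :
  n.+1%:R * b n.+1 = \sum_(k < n.+1) k.+1%:R * c k.+1 * b (n - k)%N.
Proof.
rewrite {1}/exp_coef /= nth_rcons size_exp_coef_seq ltnn eqxx mulrC divfK//.
by apply: eq_bigr => k _; rewrite nth_exp_coef_seq// leq_subr.
Qed.

Hypothesis c_ge0 : forall n, 0 <= c n.

Lemma exp_coef_ge0 n : 0 <= b n.
Proof.
have [m] := ubnP n; elim: m n => // m IH [|n] nm; first by rewrite exp_coef0.
have n1 : 0 < n.+1%:R :> R by [].
rewrite -(pmulr_rge0 _ n1) exp_coefS sumr_ge0// => k _.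
rewrite mulr_ge0 ?mulr_ge0 ?ler0n// IH//.
by rewrite -ltnS; apply: leq_ltn_trans nm; rewrite ltnS leq_subr.
Qed.

(** The linear term of the exponential already contributes [c]. *)
Lemma exp_coef_ge n : c n.+1 <= b n.+1.
Proof.
have n1 : 0 < n.+1%:R :> R by [].
rewrite -(ler_pM2l n1) exp_coefS big_ord_recr /= subnn exp_coef0 mulr1.
by rewrite lerDr sumr_ge0// => k _; rewrite !mulr_ge0// exp_coef_ge0.
Qed.

Let P N : {poly R} := \poly_(i < N.+1) c i.
Let A N : {poly R} := \poly_(i < N.+1) b i.
(** The defect of the truncations in the equation [B' = C' B]. *)
Let r N : {poly R} := (P N)^`() * A N - (A N)^`().

Let coef_r N i : (r N)`_i =
  \sum_(k < i.+1) (if (k < N)%N && (i - k <= N)%N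
                   then k.+1%:R * c k.+1 * b (i - k)%N else 0)
  - (if (i < N)%N then i.+1%:R * b i.+1 else 0).
Proof.
rewrite coefB coefM coef_deriv /A coef_poly ltnS; congr (_ - _).
  apply: eq_bigr => k _; rewrite coef_deriv /P !coef_poly !ltnS.
  by case: ltnP => /= _; case: leqP => /= _;
    rewrite ?mul0rn ?mul0r ?mulr0// mulr_natl.
by case: ifP => // _; rewrite ?mul0rn// mulr_natl.
Qed.

(** In these degrees nothing is truncated, so the recurrence of [exp_coefS]
    applies. *)
Let coef_r_eq0 N i : (i < N)%N -> (r N)`_i = 0.
Proof.
move=> iN; rewrite coef_r iN exp_coefS; apply/eqP; rewrite subr_eq0; apply/eqP.
apply: eq_bigr => k _; have kN : (k < N)%N by apply: leq_trans iN; exact: ltn_ord.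
by rewrite kN /= (leq_trans (leq_subr _ _))// ltnW.
Qed.

Let coef_r_ge0 N i : 0 <= (r N)`_i.
Proof.
have [iN|Ni] := ltnP i N; first by rewrite coef_r_eq0.
rewrite coef_r ltnNge Ni /= subr0 sumr_ge0// => k _.
by case: ifP => // _; rewrite !mulr_ge0// exp_coef_ge0.
Qed.

(** Truncation only removes nonnegative terms of the sum in [exp_coefS]. *)
Let coef_r_le N i : (r N)`_i <= i.+1%:R * b i.+1.
Proof.
rewrite coef_r exp_coefS lerBlDr; apply: ler_wpDr.
  by case: ifP => // _; rewrite -exp_coefS mulr_ge0// exp_coef_ge0.
by apply: ler_sum => k _; case: ifP => // _; rewrite !mulr_ge0// exp_coef_ge0.
Qed.

Let horner_r_ge0 N t : 0 <= t -> 0 <= (r N).[t].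
Proof.
move=> t0; rewrite horner_coef sumr_ge0// => i _.
by rewrite mulr_ge0// ?coef_r_ge0 ?exprn_ge0.
Qed.

Variable C : R.
Hypothesis c_le : forall n, series c n <= C.

Let horner_sum (f : nat -> R) N : (\poly_(i < N.+1) f i).[1] = series f N.+1.
Proof.
rewrite horner_poly /series /= big_mkord.
by apply: eq_bigr => i _; rewrite expr1n mulr1.
Qed.

Let horner0_poly (f : nat -> R) N : (\poly_(i < N.+1) f i).[0] = f 0%N.
Proof. by rewrite horner_coef0 coef_poly. Qed.

Let P_le N t : 0 <= t <= 1 -> `|(P N).[t]| <= C.
Proof.
move=> /andP[t0 t1]; rewrite ger0_norm; last first.
  by rewrite horner_poly sumr_ge0// => i _; rewrite mulr_ge0// exprn_ge0.
apply: le_trans (c_le N.+1); rewrite -horner_sum !horner_poly.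
by apply: ler_sum => i _; rewrite ler_wpM2l// expr1n exprn_ile1.
Qed.

(** Since [r N] is nonnegative on [[0, 1]], [exp(-P_N) A_N] decreases there, from
    its value [1] at [0]. *)
Lemma series_exp_coef_le n : c 0 = 0 -> series b n <= expR C.
Proof.
move=> c0; case: n => [|N]; first by rewrite /series /= big_geq// expR_ge0.
rewrite -horner_sum -/(A N).
suff : expR (- (P N).[1]) * (A N).[1] <= 1.
  rewrite expRN mulrC ler_pdivrMr ?expR_gt0// mul1r => /le_trans; apply.
  rewrite ler_expR; apply: le_trans (ler_norm _) _; apply: P_le.
  by rewrite ler01 lexx.
have D (t : R) : is_derive t 1 ((expR \o (\- horner (P N))) * horner (A N))
    (- (expR (- (P N).[t]) * (r N).[t])).
  have De : is_derive t 1 (expR \o (\- horner (P N)))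
      (expR (- (P N).[t]) * (- (P N)^`().[t])).
    exact: is_derive1_comp.
  have -> : - (expR (- (P N).[t]) * (r N).[t]) =
     (expR \o (\- horner (P N))) t *: (A N)^`().[t] +
     (A N).[t] *: (expR (- (P N).[t]) * (- (P N)^`().[t])).
    have scE (x y : R) : x *: y = x * y by [].
    by rewrite /r !hornerE !scE /=; ring.
  exact: is_deriveM.
have := @le_increment R _ (cst 0) _ (cst 0) 0 1 ler01 D
  (fun t => is_derive_cst _ _ _).
rewrite subrr lerBlDr add0r => /(_ _) H.
apply: le_trans (H _) _.
  move=> t /andP[t0 _]; rewrite /= oppr_le0 mulr_ge0 ?expR_ge0//.
  exact: horner_r_ge0.
have := horner0_poly c N; rewrite -/(P N) c0 => PN0.
by rewrite !fctE /= PN0 horner0_poly exp_coef0 oppr0 expR0 mulr1.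
Qed.

Lemma cvg_series_exp_coef : c 0 = 0 -> cvgn (series b).
Proof.
move=> c0; apply: nondecreasing_is_cvgn.
  apply/nondecreasing_seqP => n; rewrite /series /= big_nat_recr//=.
  by rewrite lerDl exp_coef_ge0.
by exists (expR C) => _ [n _ <-]; exact: series_exp_coef_le.
Qed.

(** The primitive of [r N] vanishing at [0], which serves as the majorant in
    [variation_Re_expN_mul]. *)
Let H N : {poly R} := \poly_(i < (size (r N)).+1) ((r N)`_i.-1 / i%:R).

Let derivH N : (H N)^`() = r N.
Proof.
apply/polyP => i; rewrite coef_deriv coef_poly ltnS.
case: ltnP => [_|ri]; last by rewrite mul0rn nth_default.
by rewrite /= -[LHS]mulr_natr divfK.
Qed.

Let H_le N : c 0 = 0 ->
  (H N).[1] - (H N).[0] <= limn (series b) - series b N.+1.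
Proof.
move=> c0; rewrite horner0_poly invr0 mulr0 subr0 horner_poly lerBrDr.
have cb := cvg_series_exp_coef c0.
have ndb : {homo series b : n m / (n <= m)%N >-> n <= m}.
  apply/nondecreasing_seqP => n; rewrite /series /= big_nat_recr//=.
  by rewrite lerDl exp_coef_ge0.
(* An index beyond both the truncation and the degree of the primitive. *)
pose M := maxn N.+1 (size (r N)).+1.
apply: le_trans (nondecreasing_cvgn_le ndb cb M).
rewrite /series /= [leRHS](@big_cat_nat _ _ _ N.+1)//= ?leq_maxl//= [leLHS]addrC lerD2l.
rewrite -(big_mkord xpredT (fun i => (r N)`_i.-1 / i%:R * 1 ^+ i)).
have le_term i : (r N)`_i.-1 / i%:R * 1 ^+ i <= if (N < i)%N then b i else 0.
  rewrite expr1n mulr1; case: ltnP => iN; last first.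
    case: i iN => [|i] iN; first by rewrite invr0 mulr0.
    by rewrite coef_r_eq0// mul0r.
  case: i iN => // i iN.
  by rewrite ler_pdivrMr// mulrC; exact: coef_r_le.
apply: (@le_trans _ _ (\sum_(0 <= i < M) if (N < i)%N then b i else 0)).
  rewrite [leRHS](@big_cat_nat _ _ _ (size (r N)).+1)//= ?leq_maxr//=.
  apply: ler_wpDr; last by apply: ler_sum_nat => i _; exact: le_term.
  by rewrite sumr_ge0// => i _; case: ifP => // _; exact: exp_coef_ge0.
rewrite [leLHS](@big_cat_nat _ _ _ N.+1)//= ?leq_maxl//=.
rewrite big_nat big1 ?add0r; last by move=> i /andP[_ iN]; rewrite ltnNge -ltnS iN.
by rewrite !big_nat; apply: ler_sum => i /andP[-> _].
Qed.

Section disc.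
Variable z : R[i].
Hypothesis z1 : `|z| <= 1.

(** The polynomial [t |-> p (t z)], so that real [t] in [[0, 1]] sweep the radius
    ending at [z]. *)
Let toC (p : {poly R}) : {poly R[i]} :=
  map_poly (real_complex R) p \Po (z *: 'X).

Let deriv_toC p : (toC p)^`() = toC p^`() * z%:P.
Proof.
by rewrite /toC deriv_comp deriv_map derivZ derivX alg_polyC.
Qed.

Let toCM p q : toC (p * q) = toC p * toC q.
Proof. by rewrite /toC rmorphM /= comp_polyM. Qed.

Let toCB p q : toC (p - q) = toC p - toC q.
Proof. by rewrite /toC rmorphB /= comp_polyB. Qed.

Let toC_r N :
  (toC (A N))^`() - (toC (P N))^`() * toC (A N) = - (toC (r N) * z%:P).
Proof. by rewrite !deriv_toC /r toCB toCM; ring. Qed.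

Let horner_toC n (p : {poly R}) (t : R[i]) : (size p <= n)%N ->
  (toC p).[t] = \sum_(i < n) (p`_i)%:C%C * (z * t) ^+ i.
Proof.
move=> pn; rewrite /toC horner_comp hornerZ hornerX.
rewrite (@horner_coef_wide _ n); last by rewrite size_map_poly.
by apply: eq_bigr => i _; rewrite coef_map.
Qed.

Let horner_toC_poly (f : nat -> R) N :
  (toC (\poly_(i < N.+1) f i)).[1] =
  series (fun n => (f n)%:C%C * z ^+ n) N.+1.
Proof.
rewrite (@horner_toC N.+1) ?size_poly// /series /= big_mkord.
by apply: eq_bigr => i _; rewrite coef_poly ltn_ord mulr1.
Qed.

Let norm_toC_le (p : {poly R}) (t : R) : (forall i, 0 <= p`_i) ->
  0 <= t -> `|(toC p).[t%:C%C]| <= (p.[t])%:C%C.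
Proof.
move=> p0 t0; rewrite (horner_toC _ (leqnn _)) horner_coef rmorph_sum /=.
apply: le_trans (ler_norm_sum _ _ _) _; apply: ler_sum => i _.
have nC (x : R) : 0 <= x -> `|x%:C%C| = x%:C%C :> R[i].
  by move=> x0; rewrite ger0_norm// ler0c.
rewrite normrM nC// rmorphM ler_wpM2l ?ler0c// normrX normrM nC// rmorphXn.
have t0C : 0 <= t%:C%C :> R[i] by rewrite ler0c.
by apply: lerXn2r; rewrite ?nnegrE ?mulr_ge0// ler_piMl.
Qed.

Let w N := series (fun n => (c n)%:C%C * z ^+ n) N.+1.
Let s N := series (fun n => (b n)%:C%C * z ^+ n) N.+1.

(** Equal to [1] for a formal exponential without truncation. *)
Let G N : R[i] := cexp (- w N) * s N.

(** The variation of [exp(- P_N (t z)) A_N (t z)] along that radius, from its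
    value [1] at the centre. *)
Let G_le N : c 0 = 0 ->
  let e := 2 * expR C * (limn (series b) - series b N.+1) in
  `|complex.Re (G N) - 1| <= e /\ `|complex.Im (G N)| <= e.
Proof.
move=> c0 e.
pose p (t : R) := complex.Re (toC (P N)).[t%:C%C].
pose q (t : R) := complex.Im (toC (P N)).[t%:C%C].
pose u (t : R) := complex.Re (toC (A N)).[t%:C%C].
pose v (t : R) := complex.Im (toC (A N)).[t%:C%C].
pose dp (t : R) := complex.Re (toC (P N))^`().[t%:C%C].
pose dq (t : R) := complex.Im (toC (P N))^`().[t%:C%C].
pose du (t : R) := complex.Re (toC (A N))^`().[t%:C%C].
pose dv (t : R) := complex.Im (toC (A N))^`().[t%:C%C].
have Dp t : is_derive t (1 : R) p (dp t) by exact: is_derive_Re_horner.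
have Dq t : is_derive t (1 : R) q (dq t) by exact: is_derive_Im_horner.
have Du t : is_derive t (1 : R) u (du t) by exact: is_derive_Re_horner.
have Dv t : is_derive t (1 : R) v (dv t) by exact: is_derive_Im_horner.
have DH t : is_derive t (1 : R) (horner (H N)) (r N).[t].
  by rewrite -derivH; exact: is_derive_poly.
have p_le t : 0 <= t <= 1 -> `|p t| <= C.
  move=> /[dup] /andP[t0 _] t01.
  have P0 i : 0 <= (P N)`_i by rewrite coef_poly; case: ifP.
  have [+ _] := Re_Im_le (norm_toC_le P0 t0); move=> /le_trans; apply.
  by apply: le_trans (P_le N t01); exact: ler_norm.
have rE t : (toC (A N))^`().[t%:C%C] -
    (toC (P N))^`().[t%:C%C] * (toC (A N)).[t%:C%C] =
    - ((toC (r N)).[t%:C%C] * z).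
  by rewrite -hornerM -hornerN -hornerD toC_r hornerN hornerM hornerC.
have r_le t : 0 <= t <= 1 -> `|- ((toC (r N)).[t%:C%C] * z)| <= ((r N).[t])%:C%C.
  move=> /andP[t0 t1]; rewrite normrN normrM.
  apply: le_trans (norm_toC_le (coef_r_ge0 N) t0).
  by rewrite ler_piMr.
have du_le t : 0 <= t <= 1 ->
    `|du t - (dp t * u t - dq t * v t)| <= (r N).[t].
  move=> /r_le; rewrite -rE => /Re_Im_le[+ _].
  by rewrite /du /dp /u /dq /v; case: _.[_] _.[_] _.[_] => [? ?] [? ?] [? ?].
have dv_le t : 0 <= t <= 1 ->
    `|dv t - (dp t * v t + dq t * u t)| <= (r N).[t].
  move=> /r_le; rewrite -rE => /Re_Im_le[_ +].
  by rewrite /dv /dp /u /dq /v; case: _.[_] _.[_] _.[_] => [? ?] [? ?] [? ?].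
have dv_le' t : 0 <= t <= 1 ->
    `|- du t - (dp t * (\- u) t + dq t * v t)| <= (r N).[t].
  move=> /du_le; rewrite -normrN; congr (`|_| <= _); rewrite /=; ring.
have du_le' t : 0 <= t <= 1 ->
    `|dv t - (dp t * v t - dq t * (\- u) t)| <= (r N).[t].
  move=> /dv_le; congr (`|_| <= _); rewrite /=; ring.
(* The same estimates for the imaginary part, with [(v, -u)] for [(u, v)]. *)
have NDu t : is_derive t (1 : R) (\- u) (- du t) by exact: is_deriveN.
have H1 := variation_Re_expN_mul Dp Dq Du Dv DH p_le du_le dv_le.
have H2 := variation_Re_expN_mul Dp Dq Dv NDu DH p_le du_le' dv_le'.
have toC0 f : (toC (\poly_(i < N.+1) f i)).[0%:C%C] = (f 0%N)%:C%C.
  rewrite /toC horner_comp hornerZ hornerX mulr0 horner_coef0 coef_map /=.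
  by rewrite coef_poly.
have p0 : p 0 = 0 by rewrite /p toC0 c0.
have q0 : q 0 = 0 by rewrite /q toC0 c0.
have u0 : u 0 = 1 by rewrite /u toC0 exp_coef0.
have v0 : v 0 = 0 by rewrite /v toC0.
have p1 : p 1 = complex.Re (w N) by rewrite /p horner_toC_poly.
have q1 : q 1 = complex.Im (w N) by rewrite /q horner_toC_poly.
have u1 : u 1 = complex.Re (s N) by rewrite /u horner_toC_poly.
have v1 : v 1 = complex.Im (s N) by rewrite /v horner_toC_poly.
have H_e : 2 * expR C * ((H N).[1] - (H N).[0]) <= e.
  by rewrite ler_wpM2l ?mulr_ge0 ?expR_ge0// H_le.
split.
  apply: le_trans (le_trans H1 H_e); rewrite /Re_expN_mul p0 q0 u0 v0 p1 q1 u1 v1.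
  rewrite oppr0 expR0 cos0 mul0r addr0 !mul1r /G /cexp.
  case: (w N) (s N) => [x y] [x' y'] /=; rewrite cosN sinN.
  by rewrite le_eqVlt; apply/orP; left; apply/eqP; congr (`|_|); ring.
apply: le_trans (le_trans H2 H_e); rewrite /Re_expN_mul p0 q0 /= u0 v0 p1 q1 u1 v1.
rewrite oppr0 expR0 cos0 sin0 mulr0 mul0r addr0 !mul1r subr0 /G /cexp.
case: (w N) (s N) => [x y] [x' y'] /=; rewrite cosN sinN.
by rewrite le_eqVlt; apply/orP; left; apply/eqP; congr (`|_|); ring.
Qed.

Let cvg_G : c 0 = 0 ->
  (fun N => complex.Re (G N)) @ \oo --> (1 : R) /\
  (fun N => complex.Im (G N)) @ \oo --> (0 : R).
Proof.
move=> c0.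
have e0 : (fun N => 2 * expR C * (limn (series b) - series b N.+1)) @ \oo --> (0 : R).
  rewrite -[X in _ --> X](mulr0 (2 * expR C)); apply: cvgMr.
  rewrite -(subrr (limn (series b))); apply: cvgB; first exact: cvg_cst.
  rewrite (cvg_shiftS (series b)); exact: cvg_series_exp_coef.
split.
  apply: cvg_zero; apply: norm_cvg0; apply: (squeeze_cvgr _ (cvg_cst 0) e0).
  by near=> N; rewrite normr_ge0 /=; have [] := G_le N c0.
apply: norm_cvg0; apply: (squeeze_cvgr _ (cvg_cst 0) e0).
by near=> N; rewrite normr_ge0 /=; have [] := G_le N c0.
Unshelve. all: by end_near.
Qed.

(** The hypothesis asks for convergence of the exponent at the given [z] only,
    so the conclusion is available on the boundary of the disc as well. *)
Lemma cvg_exp_coef (x y : R) : c 0 = 0 ->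
  (fun N => complex.Re (series (fun n => (c n)%:C%C * z ^+ n) N)) @ \oo --> x ->
  (fun N => complex.Im (series (fun n => (c n)%:C%C * z ^+ n) N)) @ \oo --> y ->
  (fun N => complex.Re (series (fun n => (b n)%:C%C * z ^+ n) N)) @ \oo -->
    complex.Re (cexp (x +i* y)%C) /\
  (fun N => complex.Im (series (fun n => (b n)%:C%C * z ^+ n) N)) @ \oo -->
    complex.Im (cexp (x +i* y)%C).
Proof.
move=> c0 wx wy; have [G1 G2] := cvg_G c0.
have {}wx : (fun N => complex.Re (w N)) @ \oo --> x by rewrite -cvg_shiftS in wx.
have {}wy : (fun N => complex.Im (w N)) @ \oo --> y by rewrite -cvg_shiftS in wy.
have sE N : s N = cexp (w N) * G N.
  rewrite /G mulrA [X in X * _](_ : _ = 1) ?mul1r// /cexp.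
  case: (w N) => [p q] /=; rewrite cosN sinN expRN; apply/eqP.
  have e0 : expR p != 0 by rewrite gt_eqF ?expR_gt0.
  rewrite eq_complex /=; apply/andP; split; apply/eqP.
    by rewrite -(cos2Dsin2 q); field.
  by field.
have ce : (fun N => expR (complex.Re (w N))) @ \oo --> expR x.
  exact: (cvg_comp _ _ wx (@continuous_expR R x)).
have cc : (fun N => cos (complex.Im (w N))) @ \oo --> cos y.
  exact: (cvg_comp _ _ wy (@continuous_cos R y)).
have cs : (fun N => sin (complex.Im (w N))) @ \oo --> sin y.
  exact: (cvg_comp _ _ wy (@continuous_sin R y)).
split; rewrite -cvg_shiftS.
  have -> : (fun N => complex.Re (series (fun n => (b n)%:C%C * z ^+ n) N.+1)) =
      (fun N => expR (complex.Re (w N)) * (cos (complex.Im (w N)) * complex.Re (G N) -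
                sin (complex.Im (w N)) * complex.Im (G N))).
    apply/funext => N; rewrite -/(s N) sE /cexp.
    by case: (w N) (G N) => [p q] [g1 g2] /=; ring.
  have -> : complex.Re (cexp (x +i* y)%C) = expR x * (cos y * 1 - sin y * 0).
    by rewrite /cexp /=; ring.
  by apply: cvgM => //; apply: cvgB; apply: cvgM.
have -> : (fun N => complex.Im (series (fun n => (b n)%:C%C * z ^+ n) N.+1)) =
    (fun N => expR (complex.Re (w N)) * (cos (complex.Im (w N)) * complex.Im (G N) +
              sin (complex.Im (w N)) * complex.Re (G N))).
  apply/funext => N; rewrite -/(s N) sE /cexp.
  by case: (w N) (G N) => [p q] [g1 g2] /=; ring.
have -> : complex.Im (cexp (x +i* y)%C) = expR x * (cos y * 0 + sin y * 1).
  by rewrite /cexp /=; ring.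
by apply: cvgM => //; apply: cvgD; apply: cvgM.
Qed.
End disc.
End exp_coef.

(** * The sum of the inverse odd squares *)

Section basel.
Variable R : realType.

Lemma sin_le_id (x : R) : 0 <= x -> sin x <= x.
Proof.
move=> x0.
have := @le_increment R sin id cos (cst 1) 0 x x0
  (fun t => is_derive_sin t) (fun t => is_derive_id t 1).
by rewrite sin0 !subr0; apply => t _; exact: cos_le1.
Qed.

(** The inequality [x <= tan x] cleared of its denominator. *)
Lemma mul_cos_le_sin (x : R) : 0 <= x <= pi / 2 -> x * cos x <= sin x.
Proof.
move=> /andP[x0 xpi].
have D (t : R) : is_derive t 1 (id * cos : R -> R) (cos t - t * sin t).
  have scE (a b : R) : a *: b = a * b by [].
  have := is_deriveM (is_derive_id t 1) (is_derive_cos t).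
  by rewrite !scE /= mulr1 addrC mulrN.
have := @le_increment R (id * cos) sin _ cos 0 x x0 D (fun t => is_derive_sin t).
rewrite !fctE sin0 mul0r !subr0; apply => t /andP[t0 tx].
rewrite gerBl mulr_ge0// sin_ge0_pi// t0 /=.
by have := pi_ge0 R; lra.
Qed.

(** The angles of level [n.+1] are the halves of those of level [n] and the
    complements to [pi / 2] of these halves. *)
Let angle (n k : nat) : R := k.*2.+1%:R * pi / 2 ^+ n.+2.

Let angle_itv n k : (k < 2 ^ n)%N -> 0 < angle n k < pi / 2.
Proof.
move=> kn; have pi0 := pi_gt0 R.
have p2 m : 0 < 2 ^+ m :> R by rewrite exprn_gt0.
rewrite /angle divr_gt0 ?p2 ?mulr_gt0 ?ltr0n//=.
rewrite ltr_pdivrMr ?p2//.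
have -> : pi / 2 * 2 ^+ n.+2 = (2 ^ n.+1)%:R * pi :> R.
  by rewrite natrX [2 ^+ n.+2]exprS; field.
by rewrite ltr_pM2r// ltr_nat expnS; lia.
Qed.

Let inv_sin2_half (x : R) : sin (x / 2) != 0 -> cos (x / 2) != 0 ->
  (sin (x / 2)) ^- 2 + (sin (pi / 2 - x / 2)) ^- 2 = 4 * (sin x) ^- 2.
Proof.
move=> s0 c0; have -> : sin (pi / 2 - x / 2) = cos (x / 2).
  by rewrite sinB sin_pihalf cos_pihalf mul1r mul0r subr0.
rewrite [in RHS](splitr x) sinD.
have := cos2Dsin2 (x / 2); set c := cos _ in c0 *; set s := sin _ in s0 *.
move=> cs.
have -> : s ^- 2 + c ^- 2 = (c ^+ 2 + s ^+ 2) / (s ^+ 2 * c ^+ 2).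
  by field; rewrite s0 c0.
have -> : s * c + c * s = 2 * (s * c) by ring.
by rewrite cs; field; rewrite s0 c0.
Qed.

Let half_angle n k : angle n k / 2 = angle n.+1 k.
Proof. by rewrite /angle -mulrA -invfM -exprSr. Qed.

Let compl_half_angle n k : (k < 2 ^ n)%N ->
  pi / 2 - angle n k / 2 = angle n.+1 (2 ^ n.+1 - k.+1)%N.
Proof.
move=> kn; rewrite half_angle /angle.
have -> : (2 ^ n.+1 - k.+1).*2.+1 = (2 ^ n.+2 - k.*2.+1)%N.
  by rewrite !expnS; lia.
rewrite natrB; last by rewrite !expnS; lia.
rewrite natrX (exprS 2 n.+2).
have : 2 ^+ n.+2 != 0 :> R by rewrite expf_neq0.
by move: (2 ^+ n.+2) => p p0; field.
Qed.

(** By [inv_sin2_half] each angle of level [n] is replaced at level [n.+1] by two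
    angles whose inverse squared sines add up to four times the former one. *)
Let sum_inv_sin2 n :
  \sum_(0 <= k < 2 ^ n) (sin (angle n k)) ^- 2 = 2 * 4 ^+ n.
Proof.
have half (x : R) : 0 < x < pi / 2 ->
    (sin (x / 2)) ^- 2 + (sin (pi / 2 - x / 2)) ^- 2 = 4 * (sin x) ^- 2.
  move=> /andP[x0 xpi]; have pi0 := pi_gt0 R.
  rewrite inv_sin2_half//; rewrite gt_eqF//.
    by apply: sin_gt0_pihalf; apply/andP; split; lra.
  by apply: cos_gt0_pihalf; apply/andP; split; lra.
elim: n => [|n IH].
  rewrite expn0 big_nat1 expr0 mulr1 /angle mul1r.
  have pi0 := pi_gt0 R.
  have s0 : sin (pi / 2 / 2) != 0 :> R.
    by rewrite gt_eqF// sin_gt0_pihalf//; apply/andP; split; lra.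
  have c0 : cos (pi / 2 / 2) != 0 :> R.
    by rewrite gt_eqF// cos_gt0_pihalf//; apply/andP; split; lra.
  have := inv_sin2_half s0 c0; rewrite sin_pihalf.
  have -> : pi / 2 - pi / 2 / 2 = pi / 2 / 2 :> R by field.
  have -> : pi / 2 / 2 = pi / 2 ^+ 2 :> R by field.
  by rewrite expr1n invr1 mulr1; lra.
rewrite (@big_cat_nat _ _ _ (2 ^ n)%N)//=; last by rewrite leq_exp2l.
have -> : \sum_(2 ^ n <= k < 2 ^ n.+1) (sin (angle n.+1 k)) ^- 2 =
          \sum_(0 <= k < 2 ^ n) (sin (pi / 2 - angle n k / 2)) ^- 2.
  rewrite big_nat_rev /= -{1}[(2 ^ n)%N]add0n big_addn.
  have -> : (2 ^ n.+1 - 2 ^ n = 2 ^ n)%N by rewrite expnS; lia.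
  rewrite !big_nat; apply: eq_bigr => k /andP[_ kn].
  rewrite compl_half_angle//; congr ((sin (angle _ _)) ^- 2).
  by rewrite expnS; lia.
rewrite -big_split /= exprS mulrCA -IH mulr_sumr.
by rewrite !big_nat; apply: eq_bigr => k /andP[_ kn]; rewrite -half_angle half// angle_itv.
Qed.

(** From [sin x <= x <= tan x], as [tan x ^- 2 = sin x ^- 2 - 1]. *)
Let inv_sqr_bounds (x : R) : 0 < x < pi / 2 ->
  (sin x) ^- 2 - 1 <= x ^- 2 <= (sin x) ^- 2.
Proof.
move=> /andP[x0 xpi].
have s0 : 0 < sin x by rewrite sin_gt0_pihalf// x0.
have pi0 := pi_gt0 R.
have c0 : 0 < cos x by apply: cos_gt0_pihalf; apply/andP; split; lra.
have le_sx := sin_le_id (ltW x0).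
have le_xs : x * cos x <= sin x by apply: mul_cos_le_sin; rewrite !ltW.
apply/andP; split; last by rewrite lef_pV2 ?posrE ?exprn_gt0// lerXn2r ?nnegrE ?(ltW x0) ?(ltW s0).
have -> : (sin x) ^- 2 - 1 = (cos x) ^+ 2 / (sin x) ^+ 2.
  rewrite -[in RHS](addrK (sin x ^+ 2) (cos x ^+ 2)) cos2Dsin2.
  by field; rewrite gt_eqF.
rewrite ler_pdivrMr ?exprn_gt0// mulrC ler_pdivlMr ?exprn_gt0// -exprMn mulrC.
by rewrite lerXn2r ?nnegrE ?mulr_ge0 ?(ltW x0) ?(ltW s0) ?(ltW c0).
Qed.

Definition inv_odd_sqr (k : nat) : R := (k.*2.+1%:R ^+ 2)^-1.

Let sum_inv_odd_sqrE n : \sum_(0 <= k < 2 ^ n) (angle n k) ^- 2 =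
  16 * 4 ^+ n / pi ^+ 2 * series inv_odd_sqr (2 ^ n)%N.
Proof.
rewrite /series /= mulr_sumr; apply: eq_bigr => k _; rewrite /angle /inv_odd_sqr.
have -> : 4 ^+ n = (2 ^+ n) ^+ 2 :> R by rewrite -exprM mulnC exprM; congr (_ ^+ _); ring.
rewrite !exprS.
have : 2 ^+ n != 0 :> R by rewrite expf_neq0.
have : k.*2.+1%:R != 0 :> R by rewrite pnatr_eq0.
have : pi != 0 :> R by rewrite gt_eqF ?pi_gt0.
move: (2 ^+ n) (k.*2.+1%:R) pi => p q r r0 q0 p0.
by field; rewrite r0 q0 p0.
Qed.

Let series_inv_odd_sqr_bounds n :
  pi ^+ 2 / 8 - pi ^+ 2 / 16 * (2^-1) ^+ n <= series inv_odd_sqr (2 ^ n)%N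
    <= pi ^+ 2 / 8.
Proof.
have p4 : 0 < 4 ^+ n :> R by rewrite exprn_gt0.
have pi2 : 0 < pi ^+ 2 :> R by rewrite exprn_gt0 ?pi_gt0.
have pin0 : pi != 0 :> R by rewrite gt_eqF ?pi_gt0.
have K0 : 0 < 16 * 4 ^+ n / pi ^+ 2 :> R by rewrite divr_gt0// mulr_gt0.
have H : 2 * 4 ^+ n - 2 ^+ n <= \sum_(0 <= k < 2 ^ n) (angle n k) ^- 2 <= 2 * 4 ^+ n.
  rewrite -sum_inv_sin2 !big_nat; apply/andP; split; last first.
    by apply: ler_sum => k /andP[_ kn]; have /inv_sqr_bounds/andP[] := angle_itv kn.
  have -> : 2 ^+ n = \sum_(0 <= k < 2 ^ n) 1 :> R.
    by rewrite big_const_nat subn0 iter_addr_0 natrX.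
  rewrite -!big_nat -sumrB.
  rewrite !big_nat; apply: ler_sum => k /andP[_ kn].
  by have /inv_sqr_bounds/andP[] := angle_itv kn.
move: H; rewrite sum_inv_odd_sqrE => /andP[H1 H2].
rewrite -(ler_pM2l K0) -[X in _ && X](ler_pM2l K0).
apply/andP; split; [apply: le_trans H1|apply: le_trans H2 _]; rewrite le_eqVlt;
  apply/orP; left; apply/eqP.
  have -> : 4 ^+ n = (2 ^+ n) ^+ 2 :> R by rewrite -exprM mulnC exprM; congr (_ ^+ _); ring.
  rewrite exprVn; have : 2 ^+ n != 0 :> R by rewrite expf_neq0.
  move: (2 ^+ n) => p p0; move: pi pin0 => q q0.
  by field; rewrite p0 q0.
by move: pi pin0 => q q0; field.
Qed.

(** Summing [inv_sqr_bounds] over the angles of level [n] squeezes the partial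
    sum of index [2 ^ n]; monotonicity does the rest. *)
Lemma cvg_series_inv_odd_sqr : series inv_odd_sqr @ \oo --> pi ^+ 2 / 8.
Proof.
have nd : {homo series inv_odd_sqr : n m / (n <= m)%N >-> n <= m}.
  apply/nondecreasing_seqP => n; rewrite /series /= big_nat_recr//=.
  by rewrite lerDl invr_ge0 exprn_ge0.
have cv : cvgn (series inv_odd_sqr).
  apply: nondecreasing_is_cvgn => //; exists (pi ^+ 2 / 8) => _ [n _ <-].
  have /andP[_] := series_inv_odd_sqr_bounds n; apply: le_trans; apply: nd.
  by rewrite ltnW// ltn_expl.
have exp_oo : (fun n => 2 ^ n)%N @ \oo --> \oo.
  apply/cvgnyPge => M; near=> n; apply: (@leq_trans n); last by rewrite ltnW// ltn_expl.
  by near: n; exact: nbhs_infty_ge.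
have sub := cvg_comp _ _ exp_oo cv.
suff L : (series inv_odd_sqr \o (fun n => 2 ^ n)%N) @ \oo --> pi ^+ 2 / 8.
  by rewrite -(cvg_unique _ sub L).
have L0 : (fun n => pi ^+ 2 / 8 - pi ^+ 2 / 16 * (2^-1) ^+ n) @ \oo --> (pi ^+ 2 / 8 : R).
  rewrite -[X in _ --> X]subr0; apply: cvgB; first exact: cvg_cst.
  rewrite -[X in _ --> X](mulr0 (pi ^+ 2 / 16)); apply: cvgMr.
  by apply: cvg_expr; rewrite ger0_norm; lra.
apply: (squeeze_cvgr _ L0 (cvg_cst _)).
by near=> n; exact: series_inv_odd_sqr_bounds.
Unshelve. all: by end_near.
Qed.
End basel.

(** * The exponent as a power series with odd support *)

Section odd_coef.
Variable R : realType.

Definition odd_coef (n : nat) : R := if odd n then 2 / n%:R ^+ 2 else 0.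

Lemma odd_coef_ge0 n : 0 <= odd_coef n.
Proof. by rewrite /odd_coef; case: ifP => // _; rewrite divr_ge0// exprn_ge0. Qed.

Lemma series_odd_coef_double m :
  series odd_coef m.*2 = 2 * series (@inv_odd_sqr R) m.
Proof.
elim: m => [|m IH]; first by rewrite /series /= !big_geq// mulr0.
rewrite doubleS !seriesSr IH /odd_coef /= odd_double /= addr0 mulrDr; congr (_ + _).
Qed.

Lemma nondecreasing_series_odd_coef :
  {homo series odd_coef : n m / (n <= m)%N >-> n <= m}.
Proof.
apply/nondecreasing_seqP => n; rewrite /series /= big_nat_recr//=.
by rewrite lerDl odd_coef_ge0.
Qed.

Lemma cvg_series_odd_coef : series odd_coef @ \oo --> (pi ^+ 2 / 4 : R).
Proof.
have U := @cvg_series_inv_odd_sqr R.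
have le_U m : series (@inv_odd_sqr R) m <= pi ^+ 2 / 8.
  rewrite -(cvg_lim _ U)//; apply: nondecreasing_cvgn_le; last first.
    by apply/cvg_ex; exists (pi ^+ 2 / 8).
  apply/nondecreasing_seqP => n; rewrite /series /= big_nat_recr//=.
  by rewrite lerDl invr_ge0 exprn_ge0.
have cv : cvgn (series odd_coef).
  apply: nondecreasing_is_cvgn; first exact: nondecreasing_series_odd_coef.
  exists (pi ^+ 2 / 4) => _ [n _ <-].
  apply: le_trans (_ : series odd_coef n.*2 <= _).
    by apply: nondecreasing_series_odd_coef; lia.
  by rewrite series_odd_coef_double; have := le_U n; lra.
have double_oo : double @ \oo --> \oo.
  apply/cvgnyPge => M; near=> n; rewrite -addnn.
  by apply: leq_trans (leq_addr _ _); near: n; exact: nbhs_infty_ge.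
have sub := cvg_comp _ _ double_oo cv.
suff L : (series odd_coef \o double) @ \oo --> (pi ^+ 2 / 4 : R).
  by rewrite -(cvg_unique _ sub L).
rewrite (_ : _ \o _ = fun m => 2 * series (@inv_odd_sqr R) m); last first.
  by apply/funext => m; exact: series_odd_coef_double.
rewrite (_ : pi ^+ 2 / 4 = 2 * (pi ^+ 2 / 8)); last by lra.
exact: cvgMr.
Unshelve. all: by end_near.
Qed.

Lemma series_odd_coef_le n : series odd_coef n <= pi ^+ 2 / 4.
Proof.
rewrite -(cvg_lim _ cvg_series_odd_coef)//.
apply: nondecreasing_cvgn_le; first exact: nondecreasing_series_odd_coef.
by apply/cvg_ex; exists (pi ^+ 2 / 4); exact: cvg_series_odd_coef.
Qed.

Local Notation S z := (series (fun k : nat => z ^+ k.+1 / k.+1%:R ^+ 2 : R[i]^o)).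

(** The term of even index [2k] of [2 Li2 z] is [2 z^(2k) / (2k)^2], which is the
    [k]-th term of [Li2 (z^2) / 2]. *)
Lemma series_odd_coef_Li2 (z : R[i]) N :
  series (fun n => (odd_coef n)%:C%C * z ^+ n) N.+1 =
  2 * S z N - 2^-1 * S (z ^+ 2) N./2.
Proof.
elim: N => [|N IH].
  by rewrite seriesSr /series /= !big_geq// /odd_coef /= !mulr0 subr0 mul0r addr0.
rewrite seriesSr IH seriesSr -uphalfE uphalf_half.
have nz : N.+1%:R != 0 :> R[i] by rewrite pnatr_eq0.
rewrite /odd_coef /=; case: (boolP (odd N)) => oN /=.
  have -> : (1 + N./2)%N = N./2.+1 by [].
  rewrite seriesSr mul0r addr0.
  have -> : N.+1 = (N./2).+1.*2 by rewrite doubleS -[in LHS](odd_double_half N) oN.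
  rewrite -exprM mul2n -mul2n natrM.
  have h : (N./2).+1%:R != 0 :> R[i] by rewrite pnatr_eq0.
  by field.
rewrite add0n fmorph_div rmorphXn /= !rmorph_nat.
by field.
Qed.

(** The majorant [sum_k 1/k^2] is bounded through the telescoping estimate
    [sum_(k <= m) 1/k^2 <= 2 - 1/m]. *)
Lemma cvg_Li2 (z : R[i]) : `|z| <= 1 -> S z @ \oo --> (Li2 z : R[i]^o).
Proof.
move=> z1; apply: (@is_cvg_complex_series R _ (fun k => (k.+1%:R ^+ 2)^-1)).
  move=> k; rewrite normrM normfV !normrX rmorphV ?unitfE ?expf_neq0//.
  rewrite rmorphXn /= rmorph_nat normr_nat.
  by rewrite ler_piMl ?invr_ge0 ?exprn_ge0// exprn_ile1.
apply: nondecreasing_is_cvgn.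
  apply/nondecreasing_seqP => n; rewrite /series /= big_nat_recr//=.
  by rewrite lerDl invr_ge0 exprn_ge0.
exists 2 => _ [n _ <-].
suff H m : series (fun k => (k.+1%:R ^+ 2)^-1) m.+1 <= 2 - m.+1%:R^-1 :> R.
  case: n => [|n]; first by rewrite /series /= big_geq.
  by apply: le_trans (H n) _; rewrite gerBl invr_ge0.
elim: m => [|m IH]; first by rewrite /series /= big_nat1 expr1n invr1; lra.
rewrite seriesSr; apply: le_trans (lerD IH (lexx _)) _.
have n0 : (0 : R) < m.+1%:R by [].
rewrite -[m.+2%:R]natr1; move: (m.+1%:R) n0 => x x0.
rewrite -subr_ge0.
have -> : 2 - (x + 1)^-1 - (2 - x^-1 + ((x + 1) ^+ 2)^-1) =
    (x * (x + 1) ^+ 2)^-1.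
  by field; rewrite !gt_eqF//; lra.
rewrite invr_ge0 mulr_ge0//; first exact: ltW.
by rewrite exprn_ge0//; lra.
Qed.

Definition odd_exponent (z : R[i]) : R[i] := 2 * Li2 z - 2^-1 * Li2 (z ^+ 2).

Lemma cvg_odd_exponent (z : R[i]) : `|z| <= 1 ->
  series (fun n => (odd_coef n)%:C%C * z ^+ n : R[i]^o) @ \oo -->
  (odd_exponent z : R[i]^o).
Proof.
move=> z1; rewrite -cvg_shiftS.
rewrite (_ : (fun N => _) = fun N => 2 * S z N - 2^-1 * S (z ^+ 2) N./2); last first.
  by apply/funext => N; exact: series_odd_coef_Li2.
have z2 : `|z ^+ 2| <= 1 by rewrite normrX exprn_ile1.
have half_oo : half @ \oo --> \oo.
  apply/cvgnyPge => M; near=> n.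
  by rewrite geq_half_double; near: n; exact: nbhs_infty_ge.
apply: (@cvgB _ (R[i]^o : normedModType R[i])).
  by apply: cvgMr; exact: cvg_Li2.
apply: cvgMr; exact: (cvg_comp _ _ half_oo (cvg_Li2 z2)).
Unshelve. all: by end_near.
Qed.

End odd_coef.

(** * Coefficients determined by the values on the unit interval *)

Section power_series_unique.
Variable R : realType.

(** If [d n] is the first coefficient not known to vanish, then on [[0, 1]] it
    dominates the others: [|d n| x ^ n <= M x ^ (n + 1)].  Letting [x] tend to
    zero gives [d n = 0]. *)
Lemma power_series_eq0 (d : nat -> R) (M : R) :
  (forall n, series (fun k => `|d k|) n <= M) ->
  (forall x, 0 < x <= 1 -> series (fun k => d k * x ^+ k) @ \oo --> (0 : R)) ->
  forall n, d n = 0.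
Proof.
move=> dM d0 n; have [m] := ubnP n; elim: m n => // m IH n nm.
have M0 : 0 <= M by apply: le_trans (dM 0%N); rewrite /series /= big_geq.
have key (x : R) : 0 < x <= 1 -> `|d n| <= M * x.
  move=> /[dup] x01 /andP[x0 x1].
  have bnd : \forall N \near \oo,
      `|d n| * x ^+ n - M * x ^+ n.+1 <= `|series (fun k => d k * x ^+ k) N|.
    near=> N; have nN : (n < N)%N by near: N; exact: nbhs_infty_gt.
    rewrite /series /= (@big_cat_nat _ _ _ n)//=; last exact: ltnW.
    rewrite big_nat big1 ?add0r; last first.
      move=> k /andP[_ kn]; rewrite IH ?mul0r//.
      by apply: leq_trans kn _; rewrite -ltnS.
    rewrite big_ltn// lerBlDr.
    have -> : `|d n| * x ^+ n = `|d n * x ^+ n|.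
      by rewrite normrM [`|x ^+ n|]ger0_norm// exprn_ge0// ltW.
    rewrite -[in leLHS](addrK (\sum_(n.+1 <= i < N) d i * x ^+ i) (d n * x ^+ n)).
    apply: le_trans (ler_normB _ _) _; rewrite lerD2l.
    apply: le_trans (ler_norm_sum _ _ _) _.
    apply: (@le_trans _ _ (\sum_(n.+1 <= i < N) `|d i| * x ^+ n.+1)).
      rewrite !big_nat; apply: ler_sum => i /andP[ni _].
      rewrite normrM ler_wpM2l// ger0_norm ?exprn_ge0 ?(ltW x0)//.
      by rewrite ler_wiXn2l// ltW.
    rewrite -mulr_suml ler_wpM2r ?exprn_ge0 ?(ltW x0)//.
    apply: le_trans (dM N); rewrite /series /= [leRHS](@big_cat_nat _ _ _ n.+1)//=.
    by rewrite lerDr sumr_ge0.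
  have : `|d n| * x ^+ n - M * x ^+ n.+1 <= 0.
    have /cvg_norm := d0 _ x01; rewrite normr0 => L.
    rewrite -(cvg_lim _ L)//; apply: limr_ge bnd.
    by apply/cvg_ex; exists 0.
  by rewrite subr_le0 exprS mulrA ler_pM2r ?exprn_gt0.
apply/eqP; rewrite -normr_le0; apply/ler_addgt0Pr => e e0; rewrite add0r.
have M1 : 0 < M + 1 by lra.
pose x := Num.min 1 (e / (M + 1)).
have x0 : 0 < x by rewrite lt_min ltr01 divr_gt0.
apply: le_trans (key x _) _; first by rewrite x0 ge_min lexx.
apply: (@le_trans _ _ ((M + 1) * x)); first by rewrite ler_pM2r//; lra.
by rewrite mulrC -ler_pdivlMr// ge_min lexx orbT.
Unshelve. all: by end_near.
Qed.

Lemma power_series_unique (a b : nat -> R) :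
  (forall n, 0 <= a n) -> (forall n, 0 <= b n) ->
  (forall x, 0 <= x <= 1 -> exists l : R,
     series (fun n => a n * x ^+ n) @ \oo --> l /\
     series (fun n => b n * x ^+ n) @ \oo --> l) ->
  forall n, a n = b n.
Proof.
move=> a0 b0 ab n; apply/eqP; rewrite -subr_eq0; apply/eqP.
have [l [al bl]] := ab 1 ltac:(by rewrite ler01 lexx).
have le_l (f : nat -> R) N : (forall n, 0 <= f n) ->
    series (fun n => f n * 1 ^+ n) @ \oo --> l -> series f N <= l.
  move=> f0; have -> : (fun n => f n * 1 ^+ n) = f.
    by apply/funext => k; rewrite expr1n mulr1.
  move=> fl; rewrite -(cvg_lim _ fl)//; apply: nondecreasing_cvgn_le.
    by apply/nondecreasing_seqP => k; rewrite seriesSr lerDl.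
  by apply/cvg_ex; exists l.
apply: (@power_series_eq0 (fun n => a n - b n) (l + l)).
  move=> N; apply: le_trans (lerD (le_l _ N a0 al) (le_l _ N b0 bl)).
  rewrite /series /= -big_split /=; apply: ler_sum => i _.
  by apply: le_trans (ler_normB _ _) _; rewrite !ger0_norm.
move=> x /andP[x0 x1]; have [l' [al' bl']] := ab x ltac:(by rewrite x1 ltW).
rewrite -(subrr l').
have -> : series (fun k => (a k - b k) * x ^+ k) =
    (fun N => series (fun k => a k * x ^+ k) N - series (fun k => b k * x ^+ k) N).
  by apply/funext => N; rewrite /series /= -sumrB; apply: eq_bigr => k _; rewrite mulrBl.
exact: cvgB.
Qed.

End power_series_unique.

(** * The weights of the probability alpha *)

Section alpha.
Variable R : realType.

Definition alpha_coef (n : nat) : R :=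
  expR (- (pi ^+ 2 / 4)) * exp_coef (@odd_coef R) n.

Lemma alpha_coef_ge0 n : 0 <= alpha_coef n.
Proof. by rewrite mulr_ge0 ?expR_ge0// exp_coef_ge0//; exact: odd_coef_ge0. Qed.

Lemma cexpD_real (x : R) (w : R[i]) :
  cexp (x%:C%C + w) = (expR x)%:C%C * cexp w.
Proof.
case: w => p q; rewrite /cexp /= add0r expRD.
by apply/eqP; rewrite eq_complex /=; apply/andP; split; apply/eqP; ring.
Qed.

Lemma cvg_alpha_coef (z : R[i]) : `|z| <= 1 ->
  series (fun n => (alpha_coef n)%:C%C * z ^+ n : R[i]^o) @ \oo -->
  (cexp (- (pi ^+ 2 / 4)%:C%C + odd_exponent z) : R[i]^o).
Proof.
move=> z1; have := cvg_odd_exponent z1.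
case: (odd_exponent z) => p q /cvg_complexP[wx wy].
have [bx by_] := cvg_exp_coef (@odd_coef_ge0 R) (@series_odd_coef_le R) z1
  (erefl : odd_coef R 0 = 0) wx wy.
have -> : series (fun n => (alpha_coef n)%:C%C * z ^+ n : R[i]^o) =
    (fun N => (expR (- (pi ^+ 2 / 4)))%:C%C *
       series (fun n => (exp_coef (@odd_coef R) n)%:C%C * z ^+ n : R[i]^o) N).
  apply/funext => N; rewrite /series /= mulr_sumr; apply: eq_bigr => k _.
  by rewrite /alpha_coef rmorphM mulrA.
rewrite -rmorphN cexpD_real; apply: cvgMr; apply/cvg_complexP; exact: (conj bx by_).
Qed.

Lemma cvg_alpha_coef_real (x : R) : 0 <= x <= 1 ->
  series (fun n => alpha_coef n * x ^+ n) @ \oo -->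
  expR (limn (pseries (@odd_coef R) x) - pi ^+ 2 / 4).
Proof.
move=> /andP[x0 x1].
have z1 : `|x%:C%C| <= 1 :> R[i] by rewrite ger0_norm ?ler0c// lecR.
have := cvg_odd_exponent z1.
have := cvg_alpha_coef z1.
case: (odd_exponent _) => p q /cvg_complexP[/= + _] /cvg_complexP[/= wp wq].
have q0 : q = 0.
  move: wq; under eq_fun do rewrite Im_series_real; move=> wq.
  by rewrite -(cvg_lim _ wq)//; exact: lim_cst.
under eq_fun do rewrite Re_series_real; move=> L.
move: wp; under eq_fun do rewrite Re_series_real; move=> wp.
have -> : limn (pseries (@odd_coef R) x) = p by exact: cvg_lim.
move: L; rewrite q0 oppr0 addr0 cos0 sin0 !mulr1 mul0r subr0 addrC.
exact.
Qed.

Lemma alpha_coef_unique (a : nat -> {nonneg R}) : alpha_spec a ->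
  forall n, (a n)%:num = alpha_coef n.
Proof.
move=> [_ aE]; apply: power_series_unique => //; first exact: alpha_coef_ge0.
move=> x /andP[x0 x1].
have z1 : `|x%:C%C| <= 1 :> R[i] by rewrite ger0_norm ?ler0c// lecR.
have /cvg_complexP[Ha _] := aE _ z1.
have /cvg_complexP[Hb _] := cvg_alpha_coef z1.
rewrite /odd_exponent addrA in Hb.
exists (complex.Re (cexp (- (pi ^+ 2 / 4)%:C%C + 2 * Li2 x%:C%C - 2^-1 * Li2 (x%:C%C ^+ 2)))).
split.
  by move: Ha; under eq_fun do rewrite Re_series_real.
by move: Hb; under eq_fun do rewrite Re_series_real.
Qed.

End alpha.

(** * Measures carried by the natural numbers *)

Section nat_measure.
Variable R : realType.
Implicit Type a : nat -> {nonneg R}.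

Lemma eseries_EFin (f : nat -> R) (l : R) : series f @ \oo --> l ->
  (\sum_(0 <= n <oo) (f n)%:E)%E = l%:E.
Proof.
move=> fl; apply: cvg_lim => //; apply: cvg_EFin; first by apply: nearW => n; rewrite sumEFin.
by rewrite (_ : _ \o _ = series f)//; apply/funext => n; rewrite /= sumEFin.
Qed.

Lemma nat_measureE a (A : set R) :
  nat_measure a A = (\sum_(0 <= n <oo) (a n)%:num%:E * \d_(n%:R : R) A)%E.
Proof. by []. Qed.

Lemma laplace_nat_measure a (s : R) :
  laplace (nat_measure a) s =
  (\sum_(0 <= n <oo) ((a n)%:num * expR (- s) ^+ n)%:E)%E.
Proof.
have mf : measurable_fun [set: R] (EFin \o (fun x : R => expR (- (s * x)))).
  apply/measurable_EFinP; apply: measurableT_comp => //.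
  by apply: measurableT_comp => //; exact: measurable_funM.
have f0 (x : R) : [set: R] x -> (0 <= (EFin \o (fun x : R => expR (- (s * x)))) x)%E.
  by rewrite lee_fin expR_ge0.
rewrite /laplace ge0_integral_measure_series//.
apply: eq_eseriesr => n _.
rewrite ge0_integral_mscale// integral_dirac// diracT mul1e -EFinM.
by rewrite -mulNr expRM_natr.
Qed.

End nat_measure.

(** * Derivative of the exponent *)

Section odd_series.
Variable R : realType.
Local Notation c := (@odd_coef R).

(** Compared with [sum_n (n + 1) y ^ n], whose partial sums multiplied by
    [(1 - y) ^ 2] have a closed form below [1]. *)
Lemma is_cvg_pseries_linear (f : nat -> R) (M x : R) :
  (forall n, `|f n| <= M * n.+1%:R) -> `|x| < 1 -> cvgn (pseries f x).
Proof.
move=> fM x1.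
have M0 : 0 <= M by have := fM 0%N; rewrite mulr1; exact: le_trans.
set y := `|x|; have y0 : 0 <= y by exact: normr_ge0.
have d0 : 0 < 1 - y by rewrite subr_gt0.
have bnd N : (1 - y) ^+ 2 * series (fun n => n.+1%:R * y ^+ n) N =
    1 - N.+1%:R * y ^+ N + N%:R * y ^+ N.+1.
  elim: N => [|N IH]; first by rewrite /series /= big_geq//; ring.
  rewrite seriesSr mulrDr IH -[N.+2%:R]natr1 -[N.+1%:R]natr1 !exprS; ring.
apply: normed_cvg; apply: (@series_le_cvg _ _ (fun n => M * (n.+1%:R * y ^+ n))).
- by move=> n /=.
- by move=> n; rewrite !mulr_ge0 ?exprn_ge0.
- move=> n /=; rewrite normrM normrX mulrA.
  by rewrite ler_wpM2r ?exprn_ge0.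
rewrite (_ : series _ = fun N => M * series (fun n => n.+1%:R * y ^+ n) N); last first.
  by apply/funext => N; rewrite /series /= mulr_sumr.
apply: is_cvgMr; apply: nondecreasing_is_cvgn.
  apply/nondecreasing_seqP => n; rewrite seriesSr lerDl.
  by rewrite mulr_ge0 ?exprn_ge0.
exists ((1 - y) ^- 2) => _ [N _ <-].
rewrite -[leRHS]mul1r ler_pdivlMr ?exprn_gt0// mulrC bnd.
have : N%:R * y ^+ N.+1 <= N.+1%:R * y ^+ N.
  rewrite exprS mulrA ler_wpM2r ?exprn_ge0//.
  apply: (@le_trans _ _ (N%:R * 1)); last by rewrite mulr1 ler_nat.
  by rewrite ler_wpM2l// ltW.
by lra.
Qed.

(** Linear growth is allowed in the second derived series because the
    coefficients [2 (n + 1)] occur there for [artanh_coef]. *)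
Lemma is_derive_pseries (f : nat -> R) (M x : R) :
  (forall n, `|f n| <= M) ->
  (forall n, `|pseries_diffs f n| <= M) ->
  (forall n, `|pseries_diffs (pseries_diffs f) n| <= M * n.+1%:R) ->
  `|x| < 1 ->
  is_derive x (1 : R) (fun x => limn (pseries f x))
    (limn (pseries (pseries_diffs f) x)).
Proof.
move=> f0 f1 f2 x1.
have M0 : 0 <= M by exact: le_trans (f0 0%N).
have leM n : M <= M * n.+1%:R by rewrite ler_peMr// ler1n.
(* Any point strictly between [|x|] and [1] would do. *)
pose K := (1 + `|x|) / 2.
have K0 : 0 <= K by rewrite /K divr_ge0// addr_ge0.
have K1 : `|K| < 1 by rewrite ger0_norm// /K; lra.
apply: (@pseries_snd_diffs _ f K).
- by apply: (is_cvg_pseries_linear _ K1) => n; exact: le_trans (f0 n) (leM n).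
- by apply: (is_cvg_pseries_linear _ K1) => n; exact: le_trans (f1 n) (leM n).
- by apply: (is_cvg_pseries_linear _ K1); exact: f2.
- by rewrite [ltRHS]ger0_norm// /K; lra.
Qed.

(** The Taylor coefficients of [2 artanh x = ln ((1 + x) / (1 - x))]. *)
Definition artanh_coef (n : nat) : R := if odd n then 2 / n%:R else 0.

Lemma pseries_diffs_artanh_coef n :
  pseries_diffs artanh_coef n = if odd n then 0 else 2.
Proof.
rewrite /pseries_diffs /artanh_coef /=; case: (odd n); rewrite /= ?mulr0//.
by rewrite mulrC divfK.
Qed.

Lemma pseries_diffs_odd_coef n : pseries_diffs c n = artanh_coef n.+1.
Proof.
rewrite /pseries_diffs /artanh_coef /odd_coef /=; case: (odd n); rewrite /= ?mulr0//.
have : n.+1%:R != 0 :> R by rewrite pnatr_eq0.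
by move: (n.+1%:R) => p p0; field.
Qed.

Lemma artanh_coef_ge0 n : 0 <= artanh_coef n.
Proof. by rewrite /artanh_coef; case: ifP => // _; rewrite divr_ge0. Qed.

Lemma artanh_coef_le n : artanh_coef n <= 2.
Proof.
rewrite /artanh_coef; case: n => [|n]; first by rewrite /=.
by case: ifP => // _; rewrite ler_pdivrMr// ler_peMr// ler1n.
Qed.

(** Both sides vanish at [0] and have derivative [2 / (1 - x ^ 2)], written as
    [1 / (1 - x) + 1 / (1 + x)], a sum of two geometric series. *)
Lemma limn_artanh_coef (x : R) : 0 <= x < 1 ->
  limn (pseries artanh_coef x) = ln ((1 + x) / (1 - x)).
Proof.
pose A x := limn (pseries artanh_coef x).
have DA t : `|t| < 1 -> is_derive t (1 : R) A ((1 - t)^-1 + (1 + t)^-1).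
  move=> t1.
  have <- : limn (pseries (pseries_diffs artanh_coef) t) = (1 - t)^-1 + (1 + t)^-1.
    apply: cvg_lim => //.
    have := @cvg_geometric_series R 1 t t1.
    have := @cvg_geometric_series R 1 (- t); rewrite normrN => /(_ t1).
    rewrite !mul1r opprK => L2 L1.
    rewrite (_ : pseries _ _ = fun N => series (geometric 1 t) N + series (geometric 1 (- t)) N).
      exact: cvgD.
    apply/funext => N; rewrite /pseries /series /= -big_split /=.
    apply: eq_bigr => k _; rewrite pseries_diffs_artanh_coef.
    by rewrite !mul1r exprNn -signr_odd; case: (odd k); rewrite /= ?expr1 ?expr0; ring.
  apply: (@is_derive_pseries _ 2) => // n.
  - by rewrite ger0_norm ?artanh_coef_ge0// artanh_coef_le.
  - by rewrite pseries_diffs_artanh_coef; case: ifP => _; rewrite ger0_norm.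
  - rewrite {1}/pseries_diffs pseries_diffs_artanh_coef.
    by case: ifP => _; rewrite ?mulr0 ?normr0 ?mulr_ge0// ger0_norm ?mulr_ge0// mulrC.
move=> /andP[x0 x1].
pose B t := ln (1 + t) - ln (1 - t) : R.
have DB t : `|t| < 1 -> is_derive t (1 : R) B ((1 + t)^-1 + (1 - t)^-1).
  rewrite ltr_norml => /andP[t0 t1].
  have p0 : 0 < 1 + t by lra.
  have q0 : 0 < 1 - t by lra.
  have D1 : is_derive t 1 (@ln R \o (fun t => 1 + t)) ((1 + t)^-1 * 1).
    apply: is_derive1_comp; first exact: is_derive1_ln.
    by rewrite -[X in is_derive _ _ _ X]add0r; exact: is_deriveD.
  have D2 : is_derive t 1 (@ln R \o (fun t => 1 - t)) ((1 - t)^-1 * -1).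
    apply: is_derive1_comp; first exact: is_derive1_ln.
    by rewrite -[X in is_derive _ _ _ X]sub0r; exact: is_deriveB.
  have -> : (1 + t)^-1 + (1 - t)^-1 = (1 + t)^-1 * 1 - (1 - t)^-1 * -1 by ring.
  exact: is_derive_eqfun (is_deriveB D1 D2).
have DAB t : `|t| < 1 -> is_derive t (1 : R) (A \- B) 0.
  move=> t1; have -> : 0 = ((1 - t)^-1 + (1 + t)^-1) - ((1 + t)^-1 + (1 - t)^-1) :> R by ring.
  exact: is_deriveB (DA _ t1) (DB _ t1).
have lt1 t : 0 <= t <= x -> `|t| < 1.
  by move=> /andP[t0 tx]; rewrite ger0_norm//; exact: le_lt_trans x1.
have [t||u _] := @MVT_segment R (A \- B) (cst 0) 0 x x0.
- by rewrite in_itv /= => /andP[t0 tx]; apply: DAB; apply: lt1; rewrite !ltW.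
- apply: derivable_within_continuous => t; rewrite in_itv /= => /lt1 /DAB.
  by case.
rewrite mul0r /= => /eqP; rewrite subr_eq0 => /eqP.
have -> : A 0 = 0.
  apply: cvg_lim => //; rewrite (_ : pseries _ _ = cst 0); first exact: cvg_cst.
  apply/funext => N; rewrite /pseries /series /= big1// => k _.
  by rewrite expr0n; case: k => [|k]; rewrite /artanh_coef /= ?mul0r ?mulr0.
rewrite /B subr0 addr0 ln1 !subr0 => /eqP; rewrite subr_eq0 => /eqP.
by rewrite /A => ->; rewrite ln_div// posrE; lra.
Qed.

(** Differentiating [sum_(n odd) 2 x^n / n^2] gives the series of [artanh_coef]
    divided by [x]. *)
Lemma is_derive_odd_series (x : R) : 0 < x < 1 ->
  is_derive x 1 (fun x => limn (pseries c x)) (x^-1 * ln ((1 + x) / (1 - x))).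
Proof.
move=> /andP[x0 x1].
have nx1 : `|x| < 1 by rewrite ger0_norm// ltW.
have <- : limn (pseries (pseries_diffs c) x) = x^-1 * ln ((1 + x) / (1 - x)).
  rewrite -limn_artanh_coef ?(ltW x0)//.
  have cA : cvgn (pseries artanh_coef x).
    apply: (@is_cvg_pseries_linear _ 2) => // n.
    rewrite ger0_norm ?artanh_coef_ge0//; apply: le_trans (artanh_coef_le n) _.
    by rewrite ler_peMr// ler1n.
  apply: cvg_lim => //.
  rewrite (_ : pseries _ x = fun N => x^-1 * pseries artanh_coef x N.+1); last first.
    apply/funext => N; rewrite /pseries /series /= big_nat_recl//=.
    rewrite /artanh_coef /= mul0r add0r mulr_sumr; apply: eq_bigr => k _.
    by rewrite pseries_diffs_odd_coef exprS /artanh_coef /=; field; rewrite gt_eqF.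
  by apply: cvgMr; rewrite (cvg_shiftS (pseries artanh_coef x)).
apply: (@is_derive_pseries _ 2) => // n.
- rewrite ger0_norm ?odd_coef_ge0// /odd_coef; case: ifP => // nn.
  by case: n nn => // n _; rewrite ler_pdivrMr ?exprn_gt0// ler_peMr// exprn_ege1// ler1n.
- by rewrite pseries_diffs_odd_coef ger0_norm ?artanh_coef_ge0// artanh_coef_le.
- rewrite {1}/pseries_diffs pseries_diffs_odd_coef ger0_norm ?mulr_ge0 ?artanh_coef_ge0//.
  by rewrite mulrC ler_wpM2r// artanh_coef_le.
Qed.
End odd_series.

(** * The involution -ln tanh(s/2) *)

Section involution.
Variable R : realType.

(** Another form of [- ln (tanh (s / 2))]. *)
Definition dual_map (s : R) : R := ln ((1 + expR (- s)) / (1 - expR (- s))).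

Lemma expRN_itv (s : R) : 0 < s -> 0 < expR (- s) < 1.
Proof. by move=> s0; rewrite expR_gt0 expR_lt1 oppr_lt0. Qed.

Lemma expRN_dual_map (s : R) : 0 < s ->
  expR (- dual_map s) = (1 - expR (- s)) / (1 + expR (- s)).
Proof.
move=> /expRN_itv /andP[x0 x1]; rewrite /dual_map expRN lnK ?invf_div//.
by rewrite posrE divr_gt0//; lra.
Qed.

Lemma dual_map_gt0 (s : R) : 0 < s -> 0 < dual_map s.
Proof.
move=> s0; have /andP[x0 x1] := expRN_itv s0.
rewrite -oppr_lt0 -expR_lt1 expRN_dual_map// ltr_pdivrMr ?mul1r; lra.
Qed.

(** In the variable [x = expR (- s)] this is the involution
    [x |-> (1 - x) / (1 + x)]. *)
Lemma dual_mapK (s : R) : 0 < s -> dual_map (dual_map s) = s.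
Proof.
move=> s0; have /andP[x0 x1] := expRN_itv s0.
rewrite {1}/dual_map expRN_dual_map//.
set x := expR (- s) in x0 x1 *.
have -> : (1 + (1 - x) / (1 + x)) / (1 - (1 - x) / (1 + x)) = x^-1.
  by field; rewrite !gt_eqF//; lra.
by rewrite /x expRN invrK expRK.
Qed.

Lemma is_derive_expRN (s : R) : is_derive s 1 (fun s => expR (- s)) (- expR (- s)).
Proof.
have -> : - expR (- s) = expR (- s) * -1 by ring.
exact: (@is_derive1_comp R expR (fun s => - s)).
Qed.

Lemma is_derive_dual_map (s : R) : 0 < s ->
  is_derive s 1 dual_map (- (2 * expR (- s) / (1 - expR (- s) ^+ 2))).
Proof.
move=> s0; have /andP[x0 x1] := expRN_itv s0.
have p0 : 0 < 1 + expR (- s) by lra.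
have q0 : 0 < 1 - expR (- s) by lra.
have De := is_derive_expRN s.
have D1 : is_derive s 1 (@ln R \o (fun s => 1 + expR (- s)))
    ((1 + expR (- s))^-1 * - expR (- s)).
  apply: is_derive1_comp; first exact: is_derive1_ln.
  by rewrite -[X in is_derive _ _ _ X]add0r; exact: is_deriveD.
have D2 : is_derive s 1 (@ln R \o (fun s => 1 - expR (- s)))
    ((1 - expR (- s))^-1 * expR (- s)).
  apply: is_derive1_comp; first exact: is_derive1_ln.
  by rewrite -[expR (- s)]opprK -[X in is_derive _ _ _ X]sub0r; exact: is_deriveB.
have -> : - (2 * expR (- s) / (1 - expR (- s) ^+ 2)) =
    (1 + expR (- s))^-1 * - expR (- s) - (1 - expR (- s))^-1 * expR (- s).
  by field; rewrite !gt_eqF//; nra.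
apply: near_eq_is_derive (is_deriveB D1 D2).
near=> t.
have t0 : 0 < t by near: t; exact: lt_nbhsr.
have /andP[y0 y1] := expRN_itv t0.
by rewrite /dual_map ln_div ?posrE//; lra.
Unshelve. all: by end_near.
Qed.

(** The left-hand side is [1 / sinh (dual_map m)]. *)
Lemma inv_sinh_dual_map (m : R) : 0 < m ->
  2 * expR (- dual_map m) / (1 - expR (- dual_map m) ^+ 2) = sinh m.
Proof.
move=> m0; have /andP[y0 y1] := expRN_itv m0.
rewrite expRN_dual_map// /sinh -[expR m]invrK -expRN.
by field; rewrite !gt_eqF//; lra.
Qed.
End involution.

(** * The exponential family of alpha *)

Section alpha_measure.
Variables (R : realType) (a : nat -> {nonneg R}).
Hypothesis aE : forall n, (a n)%:num = alpha_coef R n.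

Lemma laplace_alpha (s : R) : 0 <= s -> laplace (nat_measure a) s =
  (expR (limn (pseries (@odd_coef R) (expR (- s))) - pi ^+ 2 / 4))%:E.
Proof.
move=> s0; rewrite laplace_nat_measure; apply: eseries_EFin.
under eq_fun do rewrite aE.
by apply: cvg_alpha_coef_real; rewrite expR_ge0 expR_le1 oppr_le0.
Qed.

Lemma alpha_measureT : nat_measure a setT = 1%E.
Proof.
have := laplace_alpha (lexx 0).
rewrite /laplace oppr0 expR0.
have -> : limn (pseries (@odd_coef R) 1) = pi ^+ 2 / 4.
  apply: cvg_lim => //; rewrite (_ : pseries _ _ = series (@odd_coef R)).
    exact: cvg_series_odd_coef.
  apply/funext => N; rewrite /pseries /series /=.
  by apply: eq_bigr => k _; rewrite expr1n mulr1.
rewrite subrr expR0 => <-.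
under eq_integral do rewrite mul0r oppr0 expR0.
by rewrite integral_cst// mul1e.
Qed.

(** For odd [n] the [n]-th term of the transform is at least a constant times
    [2 / n ^ 2 * (n t) ^ 3] with [t = - s / 3], hence unbounded. *)
Lemma laplace_alpha_pinfty (s : R) : s < 0 -> laplace (nat_measure a) s = +oo%E.
Proof.
move=> s0; apply/eqP; rewrite -leye_eq leNgt; apply/negP => fin.
pose L := laplace (nat_measure a) s.
pose t := - s / 3; have t0 : 0 < t by rewrite /t; lra.
pose k := expR (- (pi ^+ 2 / 4)) * (2 * t ^+ 3).
have k0 : 0 < k by rewrite /k mulr_gt0 ?expR_gt0// mulr_gt0// exprn_gt0.
have term0 n : (0 <= ((a n)%:num * expR (- s) ^+ n)%:E)%E.
  by rewrite lee_fin mulr_ge0 ?exprn_ge0 ?expR_ge0.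
have L0 : (0 <= L)%E by rewrite /L laplace_nat_measure nneseries_ge0.
have Lfin : L \is a fin_num by rewrite ge0_fin_numE.
have le_L n : odd n -> k * n%:R <= fine L.
  move=> on; have n0 : n%:R != 0 :> R by rewrite pnatr_eq0; case: n on.
  rewrite -lee_fin fineK//; apply: (@le_trans _ _ ((a n)%:num * expR (- s) ^+ n)%:E).
    rewrite lee_fin aE /alpha_coef /k -[leLHS]mulrA -[leRHS]mulrA ler_pM2l ?expR_gt0//.
    have : odd_coef R n <= exp_coef (@odd_coef R) n.
      by case: n {n0} on => // n _; apply: exp_coef_ge; exact: odd_coef_ge0.
    rewrite /odd_coef on => cb.
    have -> : expR (- s) ^+ n = expR (n%:R * t) ^+ 3.
      by rewrite -!expRM_natl; congr expR; rewrite /t; field.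
    have nt : n%:R * t <= expR (n%:R * t).
      by apply: le_trans (expR_ge1Dx _); rewrite lerDr.
    apply: (@le_trans _ _ (2 / n%:R ^+ 2 * (n%:R * t) ^+ 3)).
      rewrite le_eqVlt; apply/orP; left; apply/eqP.
      by move: (n%:R) n0 => x x0; field.
    have nt0 : 0 <= n%:R * t by rewrite mulr_ge0// ltW.
    apply: ler_pM; [by rewrite divr_ge0// exprn_ge0|exact: exprn_ge0|exact: cb|].
    by rewrite lerXn2r ?nnegrE ?expR_ge0.
  rewrite /L laplace_nat_measure.
  apply: le_trans (@nneseries_lim_ge R _ xpredT 0%N n.+1 _) => //.
  by rewrite big_nat_recr//= leeDr// sume_ge0.
(* An odd number exceeding [fine L / k]. *)
pose n := (Num.truncn (fine L / k)).+1.*2.+1.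
have := le_L n; rewrite /n /= odd_double /= => /(_ isT).
rewrite leNgt => /negP; apply.
rewrite mulrC -ltr_pdivrMr//.
apply: lt_le_trans (truncnS_gt _) _.
rewrite ler_nat; move: (Num.truncn _) => q. lia.
Qed.

Lemma laplace_domain_alpha : laplace_domain (nat_measure a) = `]0, +oo[%classic.
Proof.
have finE s : (laplace (nat_measure a) s < +oo)%E = (s \in `[0, +oo[).
  rewrite in_itv /= andbT; have [s0|s0] := leP 0 s; last by rewrite laplace_alpha_pinfty// ltxx.
  by rewrite laplace_alpha// ltry.
have -> : laplace_domain (nat_measure a) = (`[0, +oo[%classic : set R)°.
  congr interior; apply/seteqP; split => s s0.
    by suff : s \in `[0, +oo[ by []; rewrite -finE; exact: s0.
  by suff : (laplace (nat_measure a) s < +oo)%E by []; rewrite finE; exact: s0.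
by rewrite interior_itv.
Qed.

Lemma log_laplace_alpha (s : R) : 0 <= s ->
  log_laplace (nat_measure a) s =
  limn (pseries (@odd_coef R) (expR (- s))) - pi ^+ 2 / 4.
Proof. by move=> s0; rewrite /log_laplace laplace_alpha// expRK. Qed.

(** The chain rule at [x = expR (- s)]: the factor [x^-1] in the derivative of the
    exponent cancels against [dx/ds = - x]. *)
Lemma is_derive_log_laplace_alpha (s : R) : 0 < s ->
  is_derive s 1 (log_laplace (nat_measure a)) (- dual_map s).
Proof.
move=> s0; have x01 := expRN_itv s0.
have D : is_derive s 1
    ((fun x => limn (pseries (@odd_coef R) x)) \o (fun s => expR (- s)))
    ((expR (- s))^-1 * ln ((1 + expR (- s)) / (1 - expR (- s))) * - expR (- s)).
  by apply: is_derive1_comp; [exact: is_derive_odd_series|exact: is_derive_expRN].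
have E : (expR (- s))^-1 * ln ((1 + expR (- s)) / (1 - expR (- s))) * - expR (- s) - 0 =
    - dual_map s.
  by rewrite /dual_map; move: (ln _) => l; field; rewrite gt_eqF ?expR_gt0.
rewrite -E.
apply: near_eq_is_derive (is_deriveB D (is_derive_cst (pi ^+ 2 / 4) s 1)).
near=> t.
have t0 : 0 < t by near: t; exact: lt_nbhsr.
by rewrite log_laplace_alpha ?(ltW t0).
Unshelve. all: by end_near.
Qed.

Lemma neg_dlog_alpha (s : R) : 0 < s -> neg_dlog (nat_measure a) s = dual_map s.
Proof.
move=> /is_derive_log_laplace_alpha D.
by rewrite /neg_dlog derive1E derive_val opprK.
Qed.

Lemma mean_domain_alpha : mean_domain (nat_measure a) = `]0, +oo[%classic.
Proof.
rewrite /mean_domain laplace_domain_alpha; apply/seteqP; split => m /=.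
  move=> [s]; rewrite /= !in_itv /= !andbT => s0 <-.
  by rewrite neg_dlog_alpha// dual_map_gt0.
rewrite in_itv /= andbT => m0; exists (dual_map m).
  by rewrite /= in_itv /= andbT dual_map_gt0.
by rewrite neg_dlog_alpha ?dual_map_gt0// dual_mapK.
Qed.

(** The mean map is [dual_map], an involution of the positive half-line. *)
Lemma mean_inverse_alpha (m : R) : 0 < m ->
  mean_inverse (nat_measure a) m = dual_map m.
Proof.
move=> m0; have s0 := dual_map_gt0 m0.
have inD (s : R) : (s \in laplace_domain (nat_measure a)) = (0 < s).
  by rewrite laplace_domain_alpha mem_setE in_itv /= andbT.
have E : neg_dlog (nat_measure a) (dual_map m) = m by rewrite neg_dlog_alpha// dual_mapK.
rewrite -{1}E /mean_inverse; apply: pinvKV; last by rewrite inD.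
move=> s t; rewrite !inD => s0' t0'; rewrite !neg_dlog_alpha// => st.
by rewrite -(dual_mapK s0') st dual_mapK.
Qed.

Lemma variance_function_alpha (m : R) : 0 < m ->
  variance_function (nat_measure a) m = sinh m.
Proof.
move=> m0; have s0 := dual_map_gt0 m0.
rewrite /variance_function mean_inverse_alpha// derive1nS derive1n1 derive1E.
have D : is_derive (dual_map m) 1 ((log_laplace (nat_measure a))^`())%classic (sinh m).
  rewrite -inv_sinh_dual_map// -[_ / _]opprK.
  apply: near_eq_is_derive (is_deriveN (is_derive_dual_map s0)).
  near=> t; have t0 : 0 < t by near: t; exact: lt_nbhsr.
  rewrite -[RHS]opprK -[- _^`()%classic t]/(neg_dlog (nat_measure a) t).
  by rewrite neg_dlog_alpha.
by rewrite derive_val.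
Unshelve. all: by end_near.
Qed.

Lemma in_M_alpha : in_M (nat_measure a).
Proof.
split; last first.
  by exists 1; rewrite laplace_domain_alpha /= in_itv /= ltr01.
move=> x.
have [n nx an0] : exists2 n : nat, n%:R != x & 0 < (a n)%:num.
  have e0 : 0 < expR (- (pi ^+ 2 / 4)) :> R by exact: expR_gt0.
  have [->|x0] := eqVneq x 0.
    exists 1%N; first exact: oner_neq0.
    rewrite aE mulr_gt0//; apply: lt_le_trans (exp_coef_ge (@odd_coef_ge0 R) 0).
    by rewrite /odd_coef /= divr_gt0// exprn_gt0.
  by exists 0%N; [rewrite eq_sym|rewrite aE mulr_gt0// exp_coef0].
rewrite gt_eqF//; apply: (@lt_le_trans _ _ (a n)%:num%:E); first by rewrite lte_fin.
rewrite nat_measureE.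
have ge0 k : (0 <= (a k)%:num%:E * \d_(k%:R : R) (~` [set x]))%E.
  by rewrite mule_ge0.
apply: le_trans (@nneseries_lim_ge R _ xpredT 0%N n.+1 _) => //.
rewrite big_nat_recr//= diracE mem_set ?mule1; last by move=> /= /eqP; rewrite (negPf nx).
by rewrite leeDr// sume_ge0.
Qed.

Lemma dual_measure_alpha : dual_measure (nat_measure a) (nat_measure a).
Proof.
split; first exact: in_M_alpha.
  by rewrite mean_domain_alpha laplace_domain_alpha.
move=> s; rewrite laplace_domain_alpha /= in_itv /= andbT => s0.
by rewrite (neg_dlog_alpha s0) neg_dlog_alpha ?dual_map_gt0// dual_mapK.
Qed.

End alpha_measure.

Theorem proposition12 (R : realType) :
  (exists! a : nat -> {nonneg R}, alpha_spec a) /\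
  forall a : nat -> {nonneg R}, alpha_spec a ->
    [/\ in_M (nat_measure a),
        mean_domain (nat_measure a) = `]0, +oo[%classic,
        forall m : R, 0 < m -> variance_function (nat_measure a) m = sinh m &
        dual_measure (nat_measure a) (nat_measure a)].
Proof.
split; last first.
  move=> a /alpha_coef_unique aE; split.
  - exact: in_M_alpha.
  - exact: mean_domain_alpha.
  - exact: variance_function_alpha.
  - exact: dual_measure_alpha.
exists (fun n => NngNum (alpha_coef_ge0 R n)); split.
  split; first exact: alpha_measureT.
  by move=> z z1; rewrite -addrA; exact: cvg_alpha_coef.
move=> a' /alpha_coef_unique aE; apply/funext => n; apply/val_inj.
by rewrite /= aE.
Qed.
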